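(* Let $K$ satisfy Assumption K with order $p$, with support in $[-1,1]^d$, and let $f,\phi$ satisfy Assumption R3 (both stated in the context). Let the randomizing density be $\ell(l)=\frac{1}{(2\epsilon)^d}\mathbf{1}_{[-\epsilon,\epsilon]^d}(l)$ and let $$\hat\beta_N=\frac{(2\epsilon)^d}{Nh^{d+1}}\sum_{i=1}^N\phi(Z_i)\nabla K\Big(\frac{\lambda^0-\Lambda_i}{h}\Big).$$ Then, as $N\to\infty$, $h\to0$ and $\epsilon\to0$ with $\epsilon\ge h$, we have $$\mathbb{E}[\hat\beta_N]-\beta\sim C_uh^p\quad\text{and}\quad\mathrm{Var}[\hat\beta_N]\sim N^{-1}h^{-d-2}\epsilon^d\,\Sigma_u,$$ where $$C_u:=\int_{\mathbb{R}^n}\xi_K^p[f_\lambda](\lambda^0,z)\,\phi(z)\,dz,\qquad\Sigma_u:=2^d\,\mathbb{E}[\phi^2(Z^0)]\int_{\mathbb{R}^d}\nabla K(l)\nabla K(l)'\,dl.$$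
   Context: Setting. For each parameter $\lambda\in\mathbb{R}^d$, $Z(\lambda)$ is an $\mathbb{R}^n$-valued random variable with density $z\mapsto f(\lambda,z)$ with respect to Lebesgue measure; $\phi\in\mathbb{L}^\infty(\mathbb{R}^n,\mathbb{R})$; $V^\phi(\lambda):=\mathbb{E}[\phi(Z(\lambda))]$. Fix $\lambda^0\in\mathbb{R}^d$, put $Z^0:=Z(\lambda^0)$ and $\beta:=\nabla_\lambda V^\phi(\lambda^0)\in\mathbb{R}^d$. Write $f_\lambda:=\nabla_\lambda f$ and $s(\lambda,z):=\nabla_\lambda\ln f(\lambda,z)$. Standing assumptions: $f$ is smooth enough in $\lambda$ that $\beta=\mathbb{E}[\phi(Z^0)s(\lambda^0,Z^0)]=\int\phi(z)f_\lambda(\lambda^0,z)\,dz$, and $\mathbb{E}|s(\lambda^0,Z^0)|^2<\infty$. Randomization. Given $\epsilon>0$ and the density $\ell$ of the claim, $(\Lambda_i,Z_i)_{1\le i\le N}$ are $N$ independent random pairs in $\mathbb{R}^d\times\mathbb{R}^n$ with common density $\varphi(\lambda,z):=\ell(\lambda^0-\lambda)f(\lambda,z)$. The number $h>0$ is the bandwidth. Order of a kernel. For $K:\mathbb{R}^d\to\mathbb{R}$, the order is the smallest nonzero integer $p$ for which there are $j_1,\dots,j_p\in\{1,\dots,d\}$ with $\int l_{j_1}\cdots l_{j_p}K(l)\,dl\neq0$, and $\int l_{\alpha_1}\cdots l_{\alpha_r}K(l)\,dl=0$ for all $0<r<p$ and $\alpha_k\in\{1,\dots,d\}$. Assumption K.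 $K:\mathbb{R}^d\to\mathbb{R}$ is $C^1$, compactly supported, satisfies $\int K=1$, and is of order $p\ge2$. Assumption R3. For every $z$, the function $f(\cdot,z)$ is $p+1$ times differentiable, and for every integer $i\le p+1$ the function $\lambda\mapsto\nabla_\lambda^if(\lambda,z)$ is continuous at $\lambda^0$ uniformly with respect to $z\in S$, for some subset $S\subset\mathbb{R}^n$ such that $\mathrm{Supp}(\phi)\subset\mathrm{int}(S)$. Notation. For a smooth function $\psi$ on $\mathbb{R}^d\times\mathbb{R}^n$ (componentwise if vector-valued), $$\xi_K^p[\psi](\lambda,z):=\frac{(-1)^p}{p!}\sum_{j_1,\dots,j_p=1}^d\Big(\int l_{j_1}\cdots l_{j_p}K(l)\,dl\Big)\nabla^p_{\lambda_{j_1}\cdots\lambda_{j_p}}\psi(\lambda,z).$$ The prime denotes transpose and $\mathrm{Var}$ of a random vector is its covariance matrix. The symbol $\sim$ for vectors and matrices means equality of leading-order terms: $\mathbb{E}[\hat\beta_N]-\beta=C_uh^p+o(h^p)$ and $Nh^{d+2}\epsilon^{-d}\,\mathrm{Var}[\hat\beta_N]\to\Sigma_u$.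
   Formalization: Added hypothesis: φ times the increments near λ^0 of the order p+1 partials of f in λ is dominated by an integrable function of z (automatic under R3 if φ is integrable); without it the bias claim can fail for bounded non-integrable φ. *)

(* Defs.v *)
From HB Require Import structures.
From mathcomp Require Import all_boot all_order all_algebra.
From mathcomp Require Import all_classical all_reals all_analysis.

Set Implicit Arguments.
Unset Strict Implicit.
Unset Printing Implicit Defensive.

Import Order.TTheory GRing.Theory Num.Theory.
Import numFieldNormedType.Exports.

Local Open Scope classical_set_scope.
Local Open Scope ring_scope.

Definition rV_display : measure_display.
Proof. exact: default_measure_display. Qed.

Section measurable_rV.
Context {R : realType} (n : nat).

Let coord (i : 'I_n) (v : 'rV[R]_n) : R := v 0 i.

Let rV_set0 : g_sigma_preimage coord set0.
Proof. exact: sigma_algebra0. Qed.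

Let rV_setC A : g_sigma_preimage coord A -> g_sigma_preimage coord (~` A).
Proof. exact: sigma_algebraC. Qed.

Let rV_bigcup (F : _^nat) : (forall i, g_sigma_preimage coord (F i)) ->
  g_sigma_preimage coord (\bigcup_i (F i)).
Proof. exact: sigma_algebra_bigcup. Qed.

(* The product sigma-algebra of R^n, which is also its Borel sigma-algebra. *)
HB.instance Definition _ := @isMeasurable.Build rV_display 'rV[R]_n
  (g_sigma_preimage coord) rV_set0 rV_setC rV_bigcup.

Lemma measurable_coord (i : 'I_n) :
  measurable_fun [set: 'rV[R]_n] (fun v => v 0 i).
Proof.
move=> _ Y mY; rewrite setTI; apply: sub_sigma_algebra => /=.
rewrite -bigcup_seq/=; exists i => /=; first by rewrite mem_index_enum.
by exists Y => //; rewrite setTI.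
Qed.

Lemma measurable_fun_coordP d (T : measurableType d) (f : T -> 'rV[R]_n) :
  measurable_fun [set: T] f <->
  forall i, measurable_fun [set: T] (fun x => f x 0 i).
Proof.
split=> [mf i|mf].
  exact: (measurableT_comp (measurable_coord i) mf).
move=> _; apply: (@measurability _ _ _ _ _ _
  (\big[setU/set0]_(i < n) preimage_set_system setT (coord i) measurable)) => //.
move=> _ [B + <-]; rewrite -bigcup_seq => -[i _ [C mC <-]].
by rewrite setTI; exact: mf.
Qed.

End measurable_rV.

Section lebesgue_rV.
Context {R : realType}.

Definition cons_rV n (x : measurableTypeR R * 'rV[R]_n) : 'rV[R]_n.+1 :=
  \row_i oapp (fun j => x.2 0 j) (x.1 : R) (unlift ord0 i).

Lemma measurable_cons_rV n : measurable_fun setT (@cons_rV n).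
Proof.
apply/measurable_fun_coordP => i; rewrite /cons_rV.
under eq_fun do rewrite mxE.
case: unliftP => [j _|_] /=.
  exact: (measurableT_comp (measurable_coord j) measurable_snd).
exact: measurable_fst.
Qed.

HB.instance Definition _ n := isMeasurableFun.Build _ _ _ _ (@cons_rV n)
  (@measurable_cons_rV n).

Section step.
Context n (mu : {sigma_finite_measure set 'rV[R]_n -> \bar R}).

Definition lebesgue_step : set 'rV[R]_n.+1 -> \bar R :=
  pushforward (@lebesgue_measure R \x mu)%E (@cons_rV n).

Let step0 : lebesgue_step set0 = 0%E.
Proof. by rewrite /lebesgue_step /pushforward preimage_set0 measure0. Qed.

Let step_ge0 A : (0 <= lebesgue_step A)%E.
Proof. exact: measure_ge0. Qed.

Let step_sigma_additive : semi_sigma_additive lebesgue_step.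
Proof.
move=> F mF tF mUF; rewrite /lebesgue_step /pushforward preimage_bigcup.
apply: measure_semi_sigma_additive.
- by move=> k; exact: measurable_funPTI.
- apply/trivIsetP => /= i j _ _ ij; rewrite -preimage_setI.
  by move/trivIsetP : tF => /(_ _ _ _ _ ij) ->//; rewrite preimage_set0.
- by rewrite -preimage_bigcup; exact: measurable_funPTI.
Qed.

HB.instance Definition _ := isMeasure.Build _ _ _ lebesgue_step
  step0 step_ge0 step_sigma_additive.

Let uncons (v : 'rV[R]_n.+1) : measurableTypeR R * 'rV[R]_n :=
  (v 0 ord0, \row_j v 0 (lift ord0 j)).

Let measurable_uncons : measurable_fun setT uncons.
Proof.
apply/measurable_fun_pair; first exact: measurable_coord.
apply/measurable_fun_coordP => j; under eq_fun do rewrite mxE.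
exact: measurable_coord.
Qed.

Let cons_rVK : cancel (@cons_rV n) uncons.
Proof.
move=> [a v]; rewrite /uncons /cons_rV !mxE unlift_none; congr pair.
by apply/rowP => j; rewrite !mxE liftK.
Qed.

Let step_sigma_finite : sigma_finite setT lebesgue_step.
Proof.
have /sigma_finiteP[F [FT ndF Foo]] := sigma_finiteT (@lebesgue_measure R).
have /sigma_finiteP[G [GT ndG Goo]] := sigma_finiteT mu.
exists (fun k => uncons @^-1` (F k `*` G k)).
  rewrite -preimage_bigcup (_ : \bigcup_k _ = setT) ?preimage_setT//.
  apply/seteqP; split => // -[a v] _.
  have : [set: measurableTypeR R] a by [].
  have : [set: 'rV[R]_n] v by [].
  rewrite FT GT => -[k _ Gkv] [l _ Fla]; exists (maxn k l) => //; split.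
    by move: Fla; exact/subsetPset/ndF/leq_maxr.
  by move: Gkv; exact/subsetPset/ndG/leq_maxl.
move=> k; have [mF Fkoo] := Foo k; have [mG Gkoo] := Goo k; split.
  rewrite -[X in measurable X]setTI; apply: measurable_uncons => //.
  exact: measurableX.
rewrite /lebesgue_step /pushforward -comp_preimage.
rewrite (_ : uncons \o @cons_rV n = id); last first.
  by apply/funext => x; exact: cons_rVK.
by rewrite preimage_id product_measure1E// lte_mul_pinfty// ge0_fin_numE.
Qed.

HB.instance Definition _ := Measure_isSigmaFinite.Build _ _ _ lebesgue_step
  step_sigma_finite.

End step.

Fixpoint lebesgue_rV n : {sigma_finite_measure set 'rV[R]_n -> \bar R} :=
  match n with
  | 0 => dirac (0 : 'rV[R]_0)
  | n'.+1 => lebesgue_step (lebesgue_rV n')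
  end.

Lemma lebesgue_rV_box n (A : 'I_n -> set (measurableTypeR R)) :
  (forall i, measurable (A i)) ->
  lebesgue_rV n [set v | forall i, A i (v 0 i)] =
  (\prod_(i < n) lebesgue_measure (A i))%E.
Proof.
elim: n A => [|n IH] A mA /=.
  by rewrite big_ord0 diracE mem_set// => -[].
rewrite big_ord_recl -(IH (fun i => A (lift ord0 i)))//.
have mbox : measurable
    [set v : 'rV[R]_n | forall i, A (lift ord0 i) (v 0 i)].
  rewrite [X in measurable X](_ : _ = \bigcap_(i in [set: 'I_n])
      ((fun v : 'rV[R]_n => v 0 i) @^-1` A (lift ord0 i))).
    apply: fin_bigcap_measurable => // i _.
    rewrite -[X in measurable X]setTI.
    by apply: measurable_coord => //; exact: mA.
  by apply/seteqP; split => v /= h i => [_|]; exact: h.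
rewrite -product_measure1E//.
rewrite /lebesgue_step /pushforward; congr product_measure1.
apply/seteqP; split => -[a v] /= h.
  split; first by have := h ord0; rewrite mxE unlift_none.
  by move=> i /=; have := h (lift ord0 i); rewrite mxE liftK.
move=> i; rewrite mxE; case: unliftP => [j ->|->] /=; last exact: h.1.
exact: h.2.
Qed.

End lebesgue_rV.
Arguments lebesgue_rV {R} n.

Section calculus.
Context {R : realType} {d : nat}.
Implicit Types (g : 'rV[R]_d -> R) (j : 'I_d) (x : 'rV[R]_d).

Definition partial j g x : R := 'D_(delta_mx 0 j) g x.

Definition iter_partial (J : seq 'I_d) g : 'rV[R]_d -> R := foldr partial g J.

Definition grad g x : 'rV[R]_d := \row_j partial j g x.

Fixpoint times_differentiable k g : Prop :=
  if k is k'.+1 then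
    (forall x, differentiable g x) /\
    (forall j, times_differentiable k' (partial j g))
  else True.

Definition continuously_differentiable g :=
  (forall x, differentiable g x) /\ (forall j, continuous (partial j g)).

Definition supp {V : topologicalType} (g : V -> R) : set V :=
  closure [set x | g x != 0].

End calculus.

Section kernels.
Context {R : realType} {d : nat}.
Local Notation leb := (lebesgue_rV d : {measure set 'rV[R]_d -> \bar R}).

Definition moment (K : 'rV[R]_d -> R) (J : seq 'I_d) : R :=
  \int[leb]_l ((\prod_(j <- J) l 0 j) * K l).

Definition kernel_order (K : 'rV[R]_d -> R) (p : nat) :=
  [/\ (0 < p)%N,
      exists J : p.-tuple 'I_d, moment K J != 0 &
      forall r, (0 < r < p)%N -> forall J : r.-tuple 'I_d, moment K J = 0].

Definition assumption_K (K : 'rV[R]_d -> R) (p : nat) :=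
  [/\ continuously_differentiable K, compact (supp K),
      \int[leb]_l K l = 1, kernel_order K p & (2 <= p)%N].

Definition xi {n : nat} (K : 'rV[R]_d -> R) (p : nat)
    (psi : 'rV[R]_d -> 'rV[R]_n -> R) (lam : 'rV[R]_d) (z : 'rV[R]_n) : R :=
  (-1) ^+ p / (p`!)%:R *
  \sum_(J : p.-tuple 'I_d) moment K J * iter_partial J (psi^~ z) lam.

Definition ell (eps : R) (l : 'rV[R]_d) : R :=
  ((2 * eps) ^+ d)^-1 *
  \1_[set l : 'rV[R]_d | forall i, - eps <= l 0 i <= eps] l.

End kernels.

Section assumptions.
Context {R : realType} {d n : nat}.
Variables (phi : 'rV[R]_n -> R) (f : 'rV[R]_d -> 'rV[R]_n -> R).
Variables (lam0 : 'rV[R]_d) (p : nat).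
Local Notation leb := (lebesgue_rV n : {measure set 'rV[R]_n -> \bar R}).

Definition assumption_R3 :=
  (forall z, times_differentiable p.+1 (f^~ z)) /\
  exists2 S : set 'rV[R]_n, supp phi `<=` S° &
    forall i, (i <= p.+1)%N -> forall J : i.-tuple 'I_d,
    forall e, 0 < e -> \forall lam \near lam0, forall z, S z ->
      `|iter_partial J (f^~ z) lam - iter_partial J (f^~ z) lam0| < e.

(* Continuity uniform in z does not let one integrate the Taylor remainder of f
   against phi when phi is bounded but not integrable (the bias can then be of
   order h^(1/2) with a zero C_u), hence this domination. It is automatic when
   phi is integrable: see integrable_dominated_increments. *)
Definition dominated_increments :=
  exists2 g : 'rV[R]_n -> R, leb.-integrable setT (EFin \o g) &
    \forall lam \near lam0, forall (J : p.+1.-tuple 'I_d) z,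
      `|phi z| *
      `|iter_partial J (f^~ z) lam - iter_partial J (f^~ z) lam0| <= g z.

Lemma integrable_dominated_increments :
  leb.-integrable setT (EFin \o phi) -> assumption_R3 -> dominated_increments.
Proof.
move=> iphi [_ [S phiS contS]]; exists (fun z => `|phi z|).
  exact: (integrable_norm iphi).
have /filter_forall : forall J : p.+1.-tuple 'I_d, \forall lam \near lam0,
    forall z, S z ->
      `|iter_partial J (f^~ z) lam - iter_partial J (f^~ z) lam0| < 1.
  by move=> J; exact: contS.
apply: filterS => lam lamS J z.
have [->|phiz0] := eqVneq (phi z) 0; first by rewrite normr0 mul0r.
rewrite ler_piMr//; apply/ltW/lamS; apply: interior_subset; apply: phiS.
exact: subset_closure.
Qed.

End assumptions.

Section probability.
Context {R : realType} {d0 : measure_display} {Omega : measurableType d0}.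
Variable P : probability Omega R.

Definition has_density d' (T : measurableType d') (X : {RV P >-> T})
    (mu : {measure set T -> \bar R}) (g : T -> R) :=
  [/\ measurable_fun setT g, forall x, 0 <= g x &
      forall A, measurable A ->
        distribution P X A = (\int[mu]_(x in A) (g x)%:E)%E].

Definition mutually_independent d' (T : measurableType d') (N : nat)
    (X : 'I_N -> {RV P >-> T}) :=
  forall (J : {set 'I_N}) (A : 'I_N -> set T), (forall i, measurable (A i)) ->
    P (\bigcap_(i in [set` J]) (X i @^-1` A i)) =
    (\prod_(i in J) P (X i @^-1` A i))%E.

Definition mean_rV k (Y : Omega -> 'rV[R]_k) : 'rV[R]_k :=
  \row_i fine ('E_P[fun w => (Y w 0 i)%R])%E.

Definition cov_mx k (Y : Omega -> 'rV[R]_k) : 'M[R]_k :=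
  \matrix_(i, j) fine (covariance P (fun w => Y w 0 i) (fun w => Y w 0 j)).

End probability.

Section estimator.
Context {R : realType} {d n : nat}.

Definition joint_density (f : 'rV[R]_d -> 'rV[R]_n -> R) (lam0 : 'rV[R]_d)
    (eps : R) (x : 'rV[R]_d * 'rV[R]_n) : R := ell eps (lam0 - x.1) * f x.1 x.2.

Definition beta_hat (K : 'rV[R]_d -> R) (phi : 'rV[R]_n -> R)
    (lam0 : 'rV[R]_d) (h eps : R) (Omega : Type) (N : nat)
    (X : 'I_N -> Omega -> 'rV[R]_d * 'rV[R]_n) (w : Omega) : 'rV[R]_d :=
  ((2 * eps) ^+ d / (N%:R * h ^+ d.+1)) *:
  \sum_(i < N) phi (X i w).2 *: grad K (h^-1 *: (lam0 - (X i w).1)).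

(* q = (N, (h, eps)) with N -> oo, h -> 0+, eps -> 0+ and h <= eps. *)
Definition regime : set_system (nat * (R * R)) :=
  within [set q | q.2.1 <= q.2.2]
    (filter_prod \oo (filter_prod 0^'+ 0^'+)).

Global Instance regime_filter : Filter regime.
Proof. exact: within_filter. Qed.

Canonical regime_filter_on := FilterType regime regime_filter.

End estimator.

Section limits.
Context {R : realType} {d n : nat}.
Local Notation leb k := (lebesgue_rV k : {measure set 'rV[R]_k -> \bar R}).

Definition bias_vector (K : 'rV[R]_d -> R) (p : nat) (phi : 'rV[R]_n -> R)
    (f : 'rV[R]_d -> 'rV[R]_n -> R) (lam0 : 'rV[R]_d) : 'rV[R]_d :=
  \row_j \int[leb n]_z
    (xi K p (fun lam z => partial j (f^~ z) lam) lam0 z * phi z).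

Definition variance_mx (K : 'rV[R]_d -> R) (Ephi2 : R) : 'M[R]_d :=
  (2 ^+ d * Ephi2) *:
  \matrix_(i, j) \int[leb d]_l (partial i K l * partial j K l).

End limits.

(* Main.v *)
From HB Require Import structures.
Require Import Defs.
From mathcomp Require Import all_boot all_order all_algebra.
From mathcomp Require Import all_classical all_reals all_analysis.
From mathcomp Require Import measurable_realfun ring lra.

Set Implicit Arguments.
Unset Strict Implicit.
Unset Printing Implicit Defensive.

Import Order.TTheory GRing.Theory Num.Theory.
Import numFieldNormedType.Exports.

Local Open Scope classical_set_scope.
Local Open Scope ring_scope.

(** The mean. Each summand is phi(Z) dK((lam0 - Lambda)/h), whose kernel factor
    vanishes outside the box of half-width h <= eps, where the randomizing density
    is the constant (2 eps)^-d. Integrating lam first, rescaling lam = lam0 - h l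
    and integrating by parts in l (kernel_by_parts), all normalizations cancel and
    the j-th component of the mean is the integral over z of phi(z) times
      int (d_j f)(lam0 - h l, z) K(l) dl.
    Against a kernel of order p, a Taylor expansion keeps only its terms of degree
    0 and p (kernel_expansion): these are d_j f(lam0, z) and h^p xi(z), which
    integrate to the component of beta and to h^p times that of C_u. The remainder
    is at most C h^p |phi(z)| times the oscillation near lam0 of the partial
    derivatives of order p + 1 of f. That product is dominated by an integrable
    function g, and is at most e |phi| for h small by the uniform continuity on
    the support of phi. Hence the error is at most C h^p int min(g, e |phi|), and
    this integral tends to 0 with e (bias_expansion).

    The variance. The summands are independent and identically distributed, so
    the covariance is a single sum (covariance_independent_sum). In the second
    moments z is integrated first: with W(lam) = int phi^2 f(lam, .), rescaling
    leaves 2^d int W(lam0 - h l) d_iK(l) d_jK(l) dl (scaled_cov_estimator). It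
    tends to the entry of Sigma_u because W is continuous at lam0, by Scheffe's
    lemma applied to the densities f(lam, .) (density_integral_continuous). The
    product of the means contributes (h/eps)^d h^2 times a bounded quantity, and
    h <= eps.

    Two tools on R^n are built from the inductive definition of its Lebesgue
    measure: the change of variables lam = a - h l (Rintegral_affine), and the
    vanishing of the integral of a partial derivative of a function supported in
    the box [-1, 1]^n (integral_partial0). On the probabilistic side,
    expectation_density writes expectations as integrals against a density. *)

(** * Measurability and the affine change of variables on R^n *)

Section euclidean_measure.
Context {R : realType}.
Local Notation leb k := (lebesgue_rV k : {measure set 'rV[R]_k -> \bar R}).

Lemma mx_norm_le m n (A : 'M[R]_(m, n)) (e : R) : 0 <= e ->
  (forall i j, `|A i j| <= e) -> `|A| <= e.
Proof.
move=> e0 Ae; have [A0|A0] := eqVneq (mx_norm A) 0; first by rewrite /Num.norm/= A0.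
by have [[i j] Aij] := mx_norm_neq0 A0; rewrite /Num.norm/= Aij; exact: Ae.
Qed.

Lemma mx_norm_ge m n (A : 'M[R]_(m, n)) i j : `|A i j| <= `|A|.
Proof.
by rewrite /Num.norm/= mx_normrE;
  exact: (le_bigmax _ (fun ij => `|A ij.1 ij.2|) (i, j)).
Qed.

Let grid n (k : nat) (m : 'rV[int]_n) : 'rV[R]_n :=
  \row_i ((m 0 i)%:~R / k.+1%:R).

Let cell n (k : nat) (v : 'rV[R]_n) : 'rV[int]_n :=
  \row_i Num.floor (v 0 i * k.+1%:R).

Let grid_cell_dist n k (v : 'rV[R]_n) : `|v - grid k (cell k v)| <= k.+1%:R^-1.
Proof.
apply: mx_norm_le => // i j; rewrite ord1 !mxE.
set x := v 0 j; set N := k.+1%:R : R.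
have N0 : 0 < N by rewrite ltr0n.
have -> : x - (Num.floor (x * N))%:~R / N = (x * N - (Num.floor (x * N))%:~R) / N.
  by rewrite mulrBl mulfK// gt_eqF.
have /andP[h1 h2] := floor_itv (x * N).
have V0 : 0 <= N^-1 by rewrite invr_ge0 ltW.
rewrite normrM (ger0_norm V0) ler_piMl// ger0_norm ?subr_ge0//.
by rewrite lerBlDl; move: h2; rewrite intrD => /ltW.
Qed.

Let measurable_cell n k (m : 'rV[int]_n) :
  measurable [set v : 'rV[R]_n | cell k v = m].
Proof.
rewrite [X in measurable X](_ : _ = \bigcap_(i in [set: 'I_n])
    ((fun v : 'rV[R]_n => v 0 i * k.+1%:R) @^-1`
      `[(m 0 i)%:~R, (m 0 i + 1)%:~R[%classic)).
  apply: fin_bigcap_measurable => // i _; rewrite -[X in measurable X]setTI.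
  have mf : measurable_fun setT (fun v : 'rV[R]_n => v 0 i * k.+1%:R).
    by apply: measurable_funM => //; exact: measurable_coord.
  by apply: mf => //; exact: measurable_itv.
apply/seteqP; split=> [v <- i _|v /= vm].
  by rewrite /= in_itv/= !mxE; exact: floor_itv.
apply/rowP => i; rewrite mxE; apply: floor_def.
by have := vm i Logic.I; rewrite /= in_itv.
Qed.

(** A continuous function is the limit of its values at the nodes of ever finer
    grids, each of which only takes countably many values. *)
Lemma continuous_measurable_rV n (F : 'rV[R]_n -> R) :
  continuous F -> measurable_fun setT F.
Proof.
move=> cF; apply: (@measurable_fun_cvg _ _ _ _ (fun k v => F (grid k (cell k v)))).
  move=> k _ Y mY; rewrite setTI.
  rewrite [X in measurable X](_ : _ = \bigcup_(m : 'rV[int]_n)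
      (if `[< Y (F (grid k m)) >] then [set v : 'rV[R]_n | cell k v = m] else set0)).
    apply: countable_bigcupT_measurable; first exact: countableP.
    by move=> m; case: ifP => _; [exact: measurable_cell|exact: measurable0].
  apply/seteqP; split=> [v /= Yv|v [m _]].
    by exists (cell k v) => //; rewrite asboolT.
  by case: asboolP => //= Ym ->.
move=> v _; suff gv : (fun k => grid k (cell k v)) @ \oo --> v.
  exact: cvg_comp gv (cF v).
apply/cvgrPdist_le => e e0; near=> k.
apply: le_trans (grid_cell_dist k v) _.
by apply/ltW; near: k; exact: (near_infty_natSinv_lt (PosNum e0)).
Unshelve. all: end_near. Qed.

End euclidean_measure.

Section affine_change_of_variable.
Context {R : realType}.

Definition pushforward_measure d1 d2 (T1 : measurableType d1)
    (T2 : measurableType d2) (mu : {measure set T1 -> \bar R}) (s : T1 -> T2)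
    (ms : measurable_fun setT s) : {measure set T2 -> \bar R} :=
  measure_function_pushforward__canonical__measure_function_Measure mu ms.

Local Notation leb k := (lebesgue_rV k : {measure set 'rV[R]_k -> \bar R}).

Lemma measurable_affine_rV n (a : 'rV[R]_n) (h : R) :
  measurable_fun [set: 'rV[R]_n] (fun v : 'rV[R]_n => a - h *: v).
Proof.
apply/measurable_fun_coordP => i.
under eq_fun do rewrite !mxE.
by apply: measurable_funB => //; apply: measurable_funM => //; exact: measurable_coord.
Qed.

Lemma lebesgue_measure_affine (a h : R) (h0 : 0 < h) (A : set (measurableTypeR R)) :
  measurable A ->
  (lebesgue_measure A =
   h%:E * lebesgue_measure ((fun y : measurableTypeR R => (a - h * y)%R) @^-1` A))%E.
Proof.
pose T (y : measurableTypeR R) : measurableTypeR R := a - h * y.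
have mT : measurable_fun setT T.
  by apply: measurable_funB => //; exact: measurable_funM.
pose nu := (mscale (NngNum (ltW h0))
  (pushforward_measure lebesgue_measure mT)).
apply: (@lebesgue_measure_unique R nu) => _ [[x y] _ <-].
transitivity (h%:E * lebesgue_measure (T @^-1` `]x, y]))%E; last by [].
rewrite (_ : T @^-1` _ = `[(a - y) / h, (a - x) / h[%classic); last first.
  apply/seteqP; split => [z|z]; rewrite /= !in_itv/= /T ler_pdivrMr// ltr_pdivlMr//.
    by move=> /andP[? ?]; apply/andP; split; lra.
  by move=> /andP[? ?]; apply/andP; split; lra.
rewrite !lebesgue_measure_itv/= !lte_fin ltr_pM2r ?invr_gt0// ltrD2l ltrN2.
case: ifPn => _; last by rewrite mule0.
rewrite -!EFinB -EFinM; congr EFin; field.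
by rewrite gt_eqF.
Qed.

(** The map acts coordinate by coordinate, so both sides factor on products and
    uniqueness of the product measure gives the step from n to n + 1. *)
Lemma lebesgue_rV_affine n (a : 'rV[R]_n) (h : R) (h0 : 0 < h) (A : set 'rV[R]_n) :
  measurable A ->
  (lebesgue_rV n A =
   (h ^+ n)%:E * lebesgue_rV n ((fun v => (a - h *: v)%R) @^-1` A))%E.
Proof.
elim: n a A => [|n IH] a A mA.
  rewrite expr0 mul1e /= !diracE; congr ((_ : bool)%:R%:E).
  by apply/idP/idP; rewrite !inE /=; congr A; apply/rowP => -[].
pose a' : 'rV[R]_n := \row_i a 0 (lift ord0 i).
pose T (v : measurableTypeR R * 'rV[R]_n) : measurableTypeR R * 'rV[R]_n :=
  (a 0 ord0 - h * v.1, a' - h *: v.2).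
have mT : measurable_fun setT T.
  apply/measurable_fun_pair => /=.
    by apply: measurable_funB => //; apply: measurable_funM => //; exact: measurable_fst.
  exact: measurableT_comp (measurable_affine_rV a' h) measurable_snd.
pose nu := (mscale (NngNum (ltW (exprn_gt0 n.+1 h0)))
  (pushforward_measure (@lebesgue_measure R \x lebesgue_rV n)%E mT)).
rewrite /= /lebesgue_step /pushforward.
transitivity (nu (@cons_rV R n @^-1` A)).
  apply: (@product_measure_unique _ _ _ _ _ _ _ nu); last first.
    by rewrite -[X in measurable X]setTI; exact: measurable_cons_rV.
  move=> B C mB mC; transitivity
    ((h ^+ n.+1)%:E * (lebesgue_measure \x lebesgue_rV n) (T @^-1` (B `*` C)))%E; first by [].
  rewrite (_ : T @^-1` _ = ((fun y => a 0 ord0 - h * y) @^-1` B) `*`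
     ((fun v => a' - h *: v) @^-1` C)); last by apply/seteqP; split.
  rewrite product_measure1E; first last.
  - by rewrite -[X in measurable X]setTI; exact: measurable_affine_rV.
  - rewrite -[X in measurable X]setTI.
    have : measurable_fun setT
        (fun y : measurableTypeR R => a 0 ord0 - h * y : measurableTypeR R).
      by apply: measurable_funB => //; exact: measurable_funM.
    exact.
  rewrite /= (lebesgue_measure_affine (a 0 ord0) h0 mB) (IH a' _ mC).
  by rewrite exprS EFinM muleACA.
rewrite /nu /mscale/= /pushforward; congr (_ * product_measure1 _ _ _)%E.
apply/seteqP; split=> -[x v] /=; rewrite /preimage/=; congr A; apply/rowP => i;
  by rewrite !mxE; case: unliftP => [j ->|->] /=; rewrite ?mxE.
Qed.

Let lebesgue_affine_push n (a : 'rV[R]_n) (h : R) (h0 : 0 < h) (F : 'rV[R]_n -> \bar R) :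
  measurable_fun setT F -> (forall x, 0 <= F x)%E ->
  (\int[leb n]_x F x = (h ^+ n)%:E * \int[leb n]_l F (a - h *: l)%R)%E.
Proof.
move=> mF F0.
pose nu := (mscale (NngNum (ltW (exprn_gt0 n h0)))
  (pushforward_measure (leb n) (measurable_affine_rV a h))).
transitivity (\int[nu]_x F x)%E.
  by apply: eq_measure_integral => A mA _; exact: lebesgue_rV_affine.
rewrite ge0_integral_mscale//=; congr (_ * _)%E.
by rewrite ge0_integral_pushforward// ; exact: measurable_affine_rV.
Qed.

Lemma integrable_affine n (a : 'rV[R]_n) (h : R) (F : 'rV[R]_n -> R) : 0 < h ->
  (leb n).-integrable setT (EFin \o F) ->
  (leb n).-integrable setT (EFin \o (fun l => F (a - h *: l))).
Proof.
move=> h0 /integrableP[mF Foo]; apply/integrableP; split.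
  exact: measurableT_comp mF (measurable_affine_rV a h).
move: Foo; rewrite (lebesgue_affine_push a h0)//; last exact: measurableT_comp.
rewrite !ltey; apply: contraNN => /eqP/= ->.
by rewrite mulry gtr0_sg ?mul1e// exprn_gt0.
Qed.

Lemma Rintegral_affine n (a : 'rV[R]_n) (h : R) (F : 'rV[R]_n -> R) : 0 < h ->
  (leb n).-integrable setT (EFin \o F) ->
  \int[leb n]_x F x = h ^+ n * \int[leb n]_l F (a - h *: l).
Proof.
move=> h0 iF; have iFa := integrable_affine a h0 iF.
have mF := measurable_int _ iF.
rewrite -RintegralZl// /Rintegral; congr fine.
under [RHS]eq_integral do rewrite EFinM.
rewrite integralZl//.
rewrite integralE [in RHS]integralE muleBr//; last first.
  exact: integrable_add_def.
have [mFp mFn] : measurable_fun setT (EFin \o F)^\+%E /\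
    measurable_fun setT (EFin \o F)^\-%E.
  by split; [exact: measurable_funepos|exact: measurable_funeneg].
rewrite (lebesgue_affine_push a h0 mFp)// (lebesgue_affine_push a h0 mFn)//.
pose s l := a - h *: l.
by rewrite (funepos_comp (EFin \o F) s) (funeneg_comp (EFin \o F) s).
Qed.

End affine_change_of_variable.

(** * Integration by parts for functions supported in the unit box *)

Section box.
Context {R : realType}.
Local Notation leb k := (lebesgue_rV k : {measure set 'rV[R]_k -> \bar R}).

Definition box n : set 'rV[R]_n := [set l | forall i, -1 <= l 0 i <= 1].

Lemma box_norm n (l : 'rV[R]_n) : box l -> `|l| <= 1.
Proof. by move=> bl; apply: mx_norm_le => // i j; rewrite ord1 ler_norml bl. Qed.

Lemma measurable_box n : measurable (@box n).
Proof.
rewrite [X in measurable X](_ : _ = \bigcap_(i in [set: 'I_n])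
    ((fun v : 'rV[R]_n => v 0 i) @^-1` `[-1, 1]%classic)).
  apply: fin_bigcap_measurable => // i _; rewrite -[X in measurable X]setTI.
  by apply: measurable_coord => //; exact: measurable_itv.
by apply/seteqP; split=> v /= bv i => [_|];
  have := bv i; rewrite /= in_itv/= => h; exact: h.
Qed.

Lemma lebesgue_box_lty n : (lebesgue_rV n (@box n) < +oo)%E.
Proof.
have boxE : [set v : 'rV[R]_n | forall i, `[-1, 1]%classic (v 0 i)] = @box n.
  by apply/seteqP; split=> v /= bv i; have := bv i; rewrite /= in_itv.
rewrite -boxE.
have -> := @lebesgue_rV_box R n (fun=> `[-1, 1]%classic) (fun=> measurable_itv _).
under eq_bigr do rewrite lebesgue_measure_itv/=.
rewrite lte_fin; have -> : (-1 < 1 :> R) by lra.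
by rewrite -EFinB prodEFin ltry.
Qed.

Lemma compact_box n : compact (@box n).
Proof.
have := @rV_compact R n (fun=> `[-1, 1]%classic) (fun=> @segment_compact R _ _).
congr compact; apply/seteqP; split=> v /= bv i; have := bv i; by rewrite /= in_itv.
Qed.

Lemma bounded_on_box n (F : 'rV[R]_n -> R) : continuous F ->
  (forall l, ~ box l -> F l = 0) -> exists2 M, 0 <= M & forall l, `|F l| <= M.
Proof.
move=> cF F0.
have /compact_bounded[M [_ FM]] : compact (F @` @box n).
  by apply: continuous_compact; [exact: continuous_subspaceT|exact: compact_box].
exists (`|M| + 1) => [|l]; first by rewrite addr_ge0.
have [bl|nbl] := pselect (box l); last by rewrite F0// normr0 addr_ge0.
by apply: FM; [rewrite ltr_pwDr// ler_norm|exists l].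
Qed.

Lemma integrable_bounded_box n (F : 'rV[R]_n -> R) (M : R) :
  measurable_fun setT F -> (forall l, ~ box l -> F l = 0) ->
  (forall l, `|F l| <= M) -> (leb n).-integrable setT (EFin \o F).
Proof.
move=> mF F0 FM.
rewrite [EFin \o F](_ : _ = (EFin \o F) \_ (@box n)); last first.
  apply/funext => l; rewrite patchE; case: ifPn => // /negP nbl.
  by rewrite /= F0// => bl; apply: nbl; rewrite inE.
apply: (integrable_mkcond (EFin \o F) (@measurable_box n)).1.
apply: measurable_bounded_integrable; first exact: measurable_box.
- exact: lebesgue_box_lty.
- exact: measurable_funS mF.
- exists M; split; first exact: num_real.
  by move=> x Mx l _; exact: le_trans (FM l) (ltW Mx).
Qed.

Lemma integrable_continuous_box n (F : 'rV[R]_n -> R) :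
  continuous F -> (forall l, ~ box l -> F l = 0) ->
  (leb n).-integrable setT (EFin \o F).
Proof.
move=> cF F0; have [M _ FM] := bounded_on_box cF F0.
by apply: integrable_bounded_box FM => //; exact: continuous_measurable_rV.
Qed.

Lemma closed_box n : closed (@box n).
Proof. by apply: compact_closed; [exact: norm_hausdorff|exact: compact_box]. Qed.

Lemma partial_outside_box n (F : 'rV[R]_n -> R) j :
  (forall l, ~ box l -> F l = 0) -> forall l, ~ box l -> partial j F l = 0.
Proof.
move=> F0 l nbl; rewrite /partial (@near_eq_derive _ _ _ _ (cst 0)) ?derive_cst//.
have /open_nbhs_nbhs : open_nbhs l (~` @box n).
  by split=> //; apply: closed_openC; exact: closed_box.
by apply: filterS => x; exact: F0.
Qed.

End box.

Section integration_by_parts.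
Context {R : realType}.
Local Notation leb k := (lebesgue_rV k : {measure set 'rV[R]_k -> \bar R}).

(** The difference quotients of F o s and F are the same function. *)
Lemma derive_comp_affine (V W : normedModType R) (F : W -> R) (s : V -> W)
    (a v : V) (w : W) : (forall k : R, s (k *: v + a) = k *: w + s a) ->
  ('D_v (F \o s) a = 'D_w F (s a)) /\
  (derivable F (s a) w -> derivable (F \o s) a v).
Proof.
move=> sE; have E : (fun h : R => h^-1 *: (((F \o s) \o shift a) (h *: v) - (F \o s) a))
    = (fun h : R => h^-1 *: ((F \o shift (s a)) (h *: w) - F (s a))).
  by apply/funext => k /=; rewrite sE.
by rewrite /derive /derivable E.
Qed.

Lemma cons_rV_shift n (a : R * 'rV[R]_n) (k : R) (b : R * 'rV[R]_n) :
  cons_rV (k * b.1 + a.1, k *: b.2 + a.2) = k *: cons_rV b + cons_rV a.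
Proof. by apply/rowP => i; rewrite !mxE; case: unliftP => [j _|_]; rewrite /= ?mxE. Qed.

Lemma cons_rV_delta0 n : cons_rV (1, 0 : 'rV[R]_n) = delta_mx 0 ord0.
Proof.
by apply/rowP => i; rewrite !mxE eqxx; case: unliftP => [j ->|->]; rewrite /= ?mxE.
Qed.

Lemma cons_rV_delta n (j : 'I_n) :
  cons_rV (0, delta_mx 0 j : 'rV[R]_n) = delta_mx 0 (lift ord0 j).
Proof.
by apply/rowP => i; rewrite !mxE eqxx; case: unliftP => [k ->|->]; rewrite /= ?mxE.
Qed.

Lemma cons_rV_dist n (a b : R * 'rV[R]_n) :
  `|cons_rV a - cons_rV b| <= Num.max `|a.1 - b.1| `|a.2 - b.2|.
Proof.
apply: mx_norm_le => [|i j]; first by rewrite le_max normr_ge0.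
rewrite ord1 !mxE le_max; case: unliftP => [k _|_] /=; last by rewrite lexx.
apply/orP; right; have := mx_norm_ge (a.2 - b.2) 0 k.
by rewrite !mxE.
Qed.

Lemma continuous_cons_rVl n (v : 'rV[R]_n) : continuous (fun x : R => cons_rV (x, v)).
Proof.
move=> x; apply/cvgrPdist_lt => e e0; near=> y.
apply: le_lt_trans (cons_rV_dist _ _) _ => /=.
rewrite subrr normr0 gt_max e0 andbT; near: y.
by apply: cvgr_dist_lt e0; exact: cvg_id.
Unshelve. all: end_near. Qed.

Lemma continuous_cons_rVr n (x : R) : continuous (fun v : 'rV[R]_n => cons_rV (x, v)).
Proof.
move=> v; apply/(@cvgrPdist_lt _ _ _ _ (nbhs_filter v)) => e e0; near=> y.
apply: le_lt_trans (cons_rV_dist _ _) _ => /=.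
rewrite subrr normr0 gt_max e0/=; near: y.
by apply: cvgr_dist_lt e0; exact: cvg_id.
Unshelve. all: end_near. Qed.

Lemma cons_rV_box n (x : R) (v : 'rV[R]_n) :
  box (cons_rV (x, v)) <-> -1 <= x <= 1 /\ box v.
Proof.
split=> [b|[bx bv] i].
  split; first by have := b ord0; rewrite mxE unlift_none.
  by move=> i; have := b (lift ord0 i); rewrite mxE liftK.
by rewrite mxE; case: unliftP => [j _|_] /=; [exact: bv|].
Qed.

Lemma integrable_rVS n (G : 'rV[R]_n.+1 -> \bar R) :
  (leb n.+1).-integrable setT G ->
  (@lebesgue_measure R \x lebesgue_rV n)%E.-integrable setT (G \o @cons_rV R n).
Proof.
move=> /integrableP[mG Goo]; apply/integrableP; split.
  exact: measurableT_comp mG (@measurable_cons_rV R n).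
move: Goo; rewrite (_ : (\int[leb n.+1]_x `|G x|)%E =
  (\int[pushforward (@lebesgue_measure R \x lebesgue_rV n)%E
     (@cons_rV R n)]_x `|G x|)%E); last first.
  by apply: eq_measure_integral.
rewrite ge0_integral_pushforward//; exact: measurableT_comp.
Qed.

Lemma integral_rVS n (G : 'rV[R]_n.+1 -> \bar R) :
  (leb n.+1).-integrable setT G ->
  (\int[leb n.+1]_x G x =
   \int[(@lebesgue_measure R \x lebesgue_rV n)%E]_z G (cons_rV z))%E.
Proof.
move=> iG; transitivity
  (\int[pushforward (@lebesgue_measure R \x lebesgue_rV n)%E (@cons_rV R n)]_x (G x))%E.
  exact: eq_measure_integral.
rewrite integral_pushforward//; last exact: integrable_rVS.
exact: measurable_int iG.
Qed.

Let integral_derive0 (u u' : R -> R) : continuous u' ->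
  (forall x : R, is_derive x 1 u (u' x)) ->
  (forall x, ~~ (-1 <= x <= 1) -> u x = 0 /\ u' x = 0) ->
  (\int[lebesgue_measure]_x (u' x)%:E = 0)%E.
Proof.
move=> cu' du u0.
have u20 : u 2 = 0 /\ u (-2) = 0.
  by split; apply: (u0 _ _).1; rewrite negb_and; apply/orP; lra.
transitivity (\int[lebesgue_measure]_(x in `[(-2 : R)%R, 2%R]) (u' x)%:E)%E.
  rewrite [RHS]integral_mkcond; apply: eq_integral => x _.
  rewrite patchE; case: ifPn => // /negP nx; rewrite (u0 x _).2//.
  apply/negP => /andP[x1 x2]; apply: nx; rewrite inE /= in_itv/=.
  by apply/andP; split; lra.
rewrite (@continuous_FTC2 _ u' u) ?u20.1 ?u20.2 ?subee//.
- lra.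
- exact: continuous_subspaceT.
- have cu x : {for x, continuous u}.
    by apply/differentiable_continuous/derivable1_diffP; have [] := du x.
  split=> [x _||].
  + by have [] := du x.
  + by apply: cvg_at_right_filter; exact: cu.
  + by apply: cvg_at_left_filter; exact: cu.
- by move=> x _; rewrite derive1E derive_val.
Qed.

Let derive_sliceR n (F : 'rV[R]_n.+1 -> R) (j : 'I_n) (x : R) (v : 'rV[R]_n) :
  partial j (fun w => F (cons_rV (x, w))) v =
    partial (lift ord0 j) F (cons_rV (x, v)) /\
  (derivable F (cons_rV (x, v)) (delta_mx 0 (lift ord0 j)) ->
   derivable (fun w => F (cons_rV (x, w))) v (delta_mx 0 j)).
Proof.
apply: (@derive_comp_affine _ _ F (fun w => cons_rV (x, w))) => k.
by rewrite -cons_rV_delta -cons_rV_shift/= mulr0 add0r.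
Qed.

Let derive_sliceL n (F : 'rV[R]_n.+1 -> R) (x : R) (v : 'rV[R]_n) :
  'D_1 (fun y : R => F (cons_rV (y, v))) x = partial ord0 F (cons_rV (x, v)) /\
  (derivable F (cons_rV (x, v)) (delta_mx 0 ord0) ->
   derivable (fun y : R => F (cons_rV (y, v))) x 1).
Proof.
apply: (@derive_comp_affine _ _ F (fun y : R => cons_rV (y, v))) => k.
by rewrite -cons_rV_delta0 -cons_rV_shift/= scaler0 add0r.
Qed.

(** Integrating first along the j-th axis, this is the fundamental theorem of
    calculus; the induction on n reaches the j-th axis through Fubini. *)
Lemma integral_partial0 n (F : 'rV[R]_n -> R) (j : 'I_n) :
  (forall x, derivable F x (delta_mx 0 j)) -> continuous (partial j F) ->
  (forall l, ~ box l -> F l = 0) ->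
  (\int[leb n]_x (partial j F x)%:E = 0)%E.
Proof.
elim: n F j => [? []//|n IH] F j dF cF F0.
have dF0 := partial_outside_box j F0.
have iF := integrable_continuous_box cF dF0.
rewrite (integral_rVS iF).
have := integrable_rVS iF.
have [j' jE|jE] := unliftP ord0 j => iF'.
- rewrite -integral12_prod_meas1//; apply: integral0_eq => x _.
  rewrite /fubini_F/= -(IH (fun v => F (cons_rV (x, v))) j').
  + by apply: eq_integral => v _; rewrite (derive_sliceR F j' x v).1 jE.
  + by move=> v; apply: (derive_sliceR F j' x v).2; rewrite -jE.
  + rewrite (_ : partial j' _ = partial j F \o (fun v => cons_rV (x, v))).
      by move=> v; apply: continuous_comp; [exact: continuous_cons_rVr|exact: cF].
    by apply/funext => v; rewrite (derive_sliceR F j' x v).1 jE.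
  + by move=> l nbl; apply: F0 => /cons_rV_box[].
- rewrite -integral21_prod_meas1//; apply: integral0_eq => v _.
  rewrite /fubini_G/=; apply: (@integral_derive0 (fun x => F (cons_rV (x, v)))).
  + by move=> x; apply: continuous_comp; [exact: continuous_cons_rVl|exact: cF].
  + move=> x; have [h1 h2] := derive_sliceL F x v.
    by split; [apply: h2; rewrite -jE|rewrite h1 jE].
  + by move=> x nx; split; [apply: F0|apply: dF0]; move=> /cons_rV_box[bx _]; rewrite bx in nx.
Qed.

End integration_by_parts.

(** * Taylor expansion against a kernel *)

Section taylor.
Context {R : realType}.

Lemma is_derive_bigsum (I : finType) (V : normedModType R) (H : I -> V -> R)
    (dH : I -> R) (x v : V) : (forall i, is_derive x v (H i) (dH i)) ->
  is_derive x v (fun y => \sum_i H i y) (\sum_i dH i).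
Proof.
move=> HdH; rewrite (_ : (fun y => _) = \sum_i H i); last by rewrite fct_sumE.
elim/big_ind2 : _ => [|f df g dg fdf gdg|i _]; last exact: HdH.
- exact: is_derive_cst.
- exact: is_deriveD.
Qed.

(** Induction on the order: the error of the expansion of u_0 vanishes at 0 and
    its derivative is the error of the expansion of u_1. *)
Lemma taylor_error (p : nat) (u : nat -> R -> R) (M : R) :
  (forall k, (k < p)%N -> forall t : R, is_derive t 1 (u k) (u k.+1 t)) ->
  (forall t, 0 <= t <= 1 -> `|u p t - u p 0| <= M) ->
  forall t, 0 <= t <= 1 ->
    `|u 0 t - \sum_(k < p.+1) u k 0 / k`!%:R * t ^+ k| <= M.
Proof.
elim: p u => [|p IH] u du uM t t01.
  by rewrite big_ord1 fact0 divr1 expr0 mulr1; exact: uM.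
pose D s := u 0 s - \sum_(k < p.+2) u k 0 / k`!%:R * s ^+ k.
pose dD s := u 1 s - \sum_(k < p.+1) u k.+1 0 / k`!%:R * s ^+ k.
have dDM s : 0 <= s <= 1 -> `|dD s| <= M.
  by apply: (IH (fun k => u k.+1)) => // k kp; exact: du.
have DdD (s : R) : is_derive s 1 D (dD s).
  apply: is_deriveB; first exact: du.
  rewrite [X in is_derive _ _ _ X](_ : _ = \sum_(k < p.+2)
      u k 0 / k`!%:R * (k%:R * s ^+ k.-1)).
    apply: is_derive_bigsum => k.
    have dX : is_derive s 1 (fun y : R => y ^+ k) (k%:R * s ^+ k.-1).
      by split; [exact: exprn_derivable|rewrite exp_derive /GRing.scale/= mulr1].
    exact: (is_deriveZ (u k 0 / k`!%:R) dX).
  rewrite [RHS]big_ord_recl/= mul0r mulr0 add0r; apply: eq_bigr => k _.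
  rewrite /bump/= add1n factS natrM.
  have cancel (a b y z : R) : a != 0 -> b != 0 -> y / (a * b) * (a * z) = y / b * z.
    by move=> a0 b0; field; rewrite a0 b0.
  by apply/esym/cancel; rewrite pnatr_eq0// -lt0n fact_gt0.
have D0 : D 0 = 0.
  rewrite /D big_ord_recl/= fact0 divr1 expr0 mulr1 big1 ?addr0 ?subrr// => k _.
  by rewrite expr0n/= mulr0.
have [t0 t1] := andP t01.
have cD : {within `[0, t], continuous D}.
  apply: continuous_subspaceT => x.
  by apply/differentiable_continuous/derivable1_diffP; have [] := DdD x.
have [c] := MVT_segment t0 (fun x _ => DdD x) cD.
rewrite in_itv/= => /andP[c0 ct]; rewrite -/(D t) D0 !subr0 => ->.
rewrite normrM (ger0_norm t0) -[M]mulr1 ler_pM// dDM//.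
by rewrite c0 (le_trans ct).
Qed.

End taylor.

Section iterated_partials.
Context {R : realType} {d : nat}.
Implicit Types (G : 'rV[R]_d -> R) (x v : 'rV[R]_d).

Lemma derive_partial G x v : differentiable G x ->
  'D_v G x = \sum_i v 0 i * partial i G x.
Proof.
move=> dG; rewrite deriveE// {1}[v]row_sum_delta linear_sum/=.
by apply: eq_bigr => i _; rewrite linearZ/= /partial deriveE.
Qed.

Lemma iter_partial_rcons G (J : seq 'I_d) j :
  iter_partial (rcons J j) G = iter_partial J (partial j G).
Proof. by rewrite /iter_partial foldr_rcons. Qed.

Lemma times_differentiable_iter_partial k G (J : seq 'I_d) :
  times_differentiable k G -> (size J < k)%N ->
  forall x, differentiable (iter_partial J G) x.
Proof.
elim/last_ind: J k G => [|J j IH] [|k] G //=; first by move=> [].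
by move=> [_ /(_ j)] dG; rewrite size_rcons ltnS iter_partial_rcons; exact: IH.
Qed.

(** The k-th derivative of G at x along v: the k-th differential at (v, .., v),
    expanded over the coordinates. *)
Definition directional k v G x : R :=
  \sum_(J : k.-tuple 'I_d) (\prod_(j <- J) v 0 j) * iter_partial J G x.

Lemma big_tuple_cons (k : nat) (F : seq 'I_d -> R) :
  \sum_(J : k.+1.-tuple 'I_d) F J = \sum_i \sum_(J : k.-tuple 'I_d) F (i :: J).
Proof.
rewrite pair_big/=.
rewrite (reindex (fun u : 'I_d * k.-tuple 'I_d => [tuple of u.1 :: u.2]))//=.
exists (fun J : k.+1.-tuple 'I_d => (thead J, [tuple of behead J])) => [[i J]|J] _ /=.
  by rewrite theadE; congr (_, _); exact: val_inj.
by rewrite -tuple_eta.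
Qed.

Lemma is_derive_directional k v G x (t : R) :
  (forall J : k.-tuple 'I_d, forall y, differentiable (iter_partial J G) y) ->
  is_derive t 1 (fun s => directional k v G (x + s *: v))
    (directional k.+1 v G (x + t *: v)).
Proof.
move=> dG; rewrite /directional (big_tuple_cons k (fun J =>
  (\prod_(j <- J) v 0 j) * iter_partial J G (x + t *: v))) exchange_big/=.
apply: is_derive_bigsum => J; set c := \prod_(j <- J) v 0 j.
have sE (a : R) : x + (a *: 1 + t) *: v = a *: v + (x + t *: v).
  by rewrite /GRing.scale/= mulr1 -/(GRing.scale _ _) scalerDl addrCA.
have [h1 h2] := derive_comp_affine (iter_partial J G) (s := fun s : R => x + s *: v)
  (a := t) (v := 1) (w := v) sE.
have : is_derive t 1 (iter_partial J G \o (fun s : R => x + s *: v))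
    (\sum_i v 0 i * partial i (iter_partial J G) (x + t *: v)).
  split; first by apply: h2; apply: diff_derivable; exact: dG.
  by rewrite h1 derive_partial.
move=> /(is_deriveZ c) /is_derive_eq; apply.
rewrite /GRing.scale/= mulr_sumr; apply: eq_bigr => i _.
by rewrite big_cons -/c [LHS]mulrA (mulrC c).
Qed.

Lemma norm_directional_diff k v G x y (r delta : R) : 0 <= r -> 0 <= delta -> `|v| <= r ->
  (forall J : k.-tuple 'I_d,
    `|iter_partial J G y - iter_partial J G x| <= delta) ->
  `|directional k v G y - directional k v G x| <= (d ^ k)%:R * r ^+ k * delta.
Proof.
move=> r0 delta0 vr Gd; rewrite /directional -sumrB.
apply: le_trans (ler_norm_sum _ _ _) _.
apply: (@le_trans _ _ (\sum_(J : k.-tuple 'I_d) r ^+ k * delta)); last first.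
  by rewrite sumr_const card_tuple card_ord -[leLHS]mulr_natl mulrA.
apply: ler_sum => J _; rewrite -mulrBr normrM ler_pM//.
rewrite -[X in _ <= r ^+ X](size_tuple J); elim: (tval J) => [|j s IH] /=.
  by rewrite big_nil normr1.
by rewrite big_cons normrM exprS ler_pM// (le_trans (mx_norm_ge v 0 j)).
Qed.

(** On the segment from x to x + v, the oscillation of the p-th derivatives bounds
    the remainder. *)
Lemma directional_taylor p G x v (r delta : R) : 0 <= r -> 0 <= delta -> `|v| <= r ->
  (forall J : seq 'I_d, (size J < p)%N -> forall y, differentiable (iter_partial J G) y) ->
  (forall (J : p.-tuple 'I_d) w, `|w| <= r ->
    `|iter_partial J G (x + w) - iter_partial J G x| <= delta) ->
  `|G (x + v) - \sum_(k < p.+1) directional k v G x / k`!%:R|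
    <= (d ^ p)%:R * r ^+ p * delta.
Proof.
move=> r0 delta0 vr dG Gd.
have := @taylor_error _ p (fun k t => directional k v G (x + t *: v))
  ((d ^ p)%:R * r ^+ p * delta).
have d0 t : directional 0 v G (x + t *: v) = G (x + t *: v).
  rewrite /directional (bigD1 [tuple])//= big_nil mul1r big1 ?addr0//.
  by move=> J /eqP[]; exact: tuple0.
move=> /(_ _ _ 1); rewrite d0 scale1r; under eq_bigr do rewrite scale0r addr0 expr1n mulr1.
apply.
- by move=> k kp t; apply: is_derive_directional => J y; apply: dG; rewrite size_tuple.
- move=> t /andP[t0 t1]; rewrite scale0r addr0; apply: norm_directional_diff => // J.
  apply: Gd; rewrite normrZ (ger0_norm t0); apply: le_trans vr.
  by rewrite ler_piMl.
- by rewrite ler01 lexx.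
Qed.

End iterated_partials.

Section kernel_expansion.
Context {R : realType} {d : nat}.
Local Notation leb := (lebesgue_rV d : {measure set 'rV[R]_d -> \bar R}).
Variable K : 'rV[R]_d -> R.
Hypothesis cK : continuous K.
Hypothesis K0 : forall l, ~ box l -> K l = 0.

Lemma continuous_monomial (J : seq 'I_d) :
  continuous (fun l : 'rV[R]_d => \prod_(j <- J) l 0 j).
Proof.
elim: J => [|j J IH].
  by under eq_fun do rewrite big_nil; exact: cst_continuous.
under eq_fun do rewrite big_cons.
by move=> l; apply: continuousM; [exact: coord_continuous|exact: IH].
Qed.

Lemma integrable_kernel_mul (F : 'rV[R]_d -> R) : continuous F ->
  leb.-integrable setT (EFin \o (fun l => F l * K l)).
Proof.
move=> cF; apply: integrable_continuous_box => [l|l nbl]; last by rewrite K0// mulr0.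
by apply: continuousM; [exact: cF|exact: cK].
Qed.

Lemma Rintegral_sum d' (T : measurableType d') (I : finType)
    (mu : {measure set T -> \bar R}) (F : I -> T -> R) :
  (forall i, mu.-integrable setT (EFin \o F i)) ->
  \int[mu]_x (\sum_i F i x) = \sum_i \int[mu]_x F i x.
Proof.
move=> iF; rewrite /Rintegral.
under eq_integral do rewrite -sumEFin.
rewrite integral_sum//.
by rewrite sum_fine// => i _; apply: integrable_fin_num => //; exact: iF.
Qed.

Lemma integral_kernel_directional k (G : 'rV[R]_d -> R) x (h : R) :
  leb.-integrable setT
    (EFin \o (fun l => directional k (- h *: l) G x * K l)) /\
  \int[leb]_l (directional k (- h *: l) G x * K l) =
  (- h) ^+ k * \sum_(J : k.-tuple 'I_d) moment K J * iter_partial J G x.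
Proof.
have E l : directional k (- h *: l) G x * K l =
    \sum_(J : k.-tuple 'I_d)
      ((- h) ^+ k * iter_partial J G x) * ((\prod_(j <- J) l 0 j) * K l).
  rewrite /directional mulr_suml; apply: eq_bigr => J _.
  have -> : \prod_(j <- J) (- h *: l) 0 j = (- h) ^+ k * \prod_(j <- J) l 0 j.
    under eq_bigr do rewrite mxE.
    rewrite big_split/= big_const_seq count_predT size_tuple; congr (_ * _).
    by rewrite GRing.iter_mulr_1.
  ring.
have iJ (J : k.-tuple 'I_d) :
    leb.-integrable setT (EFin \o (fun l : 'rV[R]_d => (\prod_(j <- J) l 0 j) * K l)).
  exact: integrable_kernel_mul (@continuous_monomial J).
have iZ (J : k.-tuple 'I_d) : leb.-integrable setT (EFin \o (fun l : 'rV[R]_d =>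
    ((- h) ^+ k * iter_partial J G x) * ((\prod_(j <- J) l 0 j) * K l))).
  exact: (integrableZl measurableT _ (iJ J)).
split.
  rewrite (_ : EFin \o _ = fun l : 'rV[R]_d => (\sum_(J : k.-tuple 'I_d) (
      ((- h) ^+ k * iter_partial J G x) * ((\prod_(j <- J) l 0 j) * K l))%:E)%E).
    by apply: integrable_sum => // J _; exact: iZ.
  by apply/funext => l; rewrite /= E sumEFin.
under eq_Rintegral do rewrite E.
rewrite Rintegral_sum// mulr_sumr; apply: eq_bigr => J _.
by rewrite RintegralZl// -mulrA (mulrC (iter_partial _ _ _)).
Qed.

(** Integrated against a kernel of order p, the Taylor polynomial of degree p
    keeps only its terms of degree 0 and p. *)
Lemma kernel_expansion (p : nat) (G : 'rV[R]_d -> R) x (h delta : R) :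
  0 <= h -> 0 <= delta -> \int[leb]_l K l = 1 -> (0 < p)%N ->
  (forall r, (0 < r < p)%N -> forall J : r.-tuple 'I_d, moment K J = 0) ->
  (forall J : seq 'I_d, (size J < p)%N -> forall y, differentiable (iter_partial J G) y) ->
  (forall (J : p.-tuple 'I_d) w, `|w| <= h ->
    `|iter_partial J G (x + w) - iter_partial J G x| <= delta) ->
  `|\int[leb]_l (G (x - h *: l) * K l) -
    (G x + h ^+ p * ((-1) ^+ p / p`!%:R *
      \sum_(J : p.-tuple 'I_d) moment K J * iter_partial J G x))|
  <= (d ^ p)%:R * h ^+ p * delta * \int[leb]_l `|K l|.
Proof.
move=> h0 delta0 K1 p0 Kp dG Gd.
pose T l := \sum_(k < p.+1) directional k (- h *: l) G x / k`!%:R.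
have iK k : leb.-integrable setT (EFin \o (fun l : 'rV[R]_d =>
    directional k (- h *: l) G x / k`!%:R * K l)).
  rewrite (_ : EFin \o _ = fun l : 'rV[R]_d =>
      ((k`!%:R^-1)%:E * (directional k (- h *: l) G x * K l)%:E)%E).
    by apply: integrableZl => //; exact: (integral_kernel_directional k G x h).1.
  by apply/funext => l /=; rewrite -EFinM; congr EFin; ring.
have iT : leb.-integrable setT (EFin \o (fun l : 'rV[R]_d => T l * K l)).
  rewrite (_ : EFin \o _ = fun l : 'rV[R]_d =>
     (\sum_(k < p.+1) (directional k (- h *: l) G x / k`!%:R * K l)%:E)%E).
    by apply: integrable_sum => // k _; exact: iK.
  by apply/funext => l; rewrite /= mulr_suml sumEFin.
have TE : \int[leb]_l (T l * K l) = G x + h ^+ p * ((-1) ^+ p / p`!%:R *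
      \sum_(J : p.-tuple 'I_d) moment K J * iter_partial J G x).
  under eq_Rintegral do rewrite mulr_suml.
  rewrite Rintegral_sum; last by move=> k; exact: iK.
  have E k : \int[leb]_l (directional k (- h *: l) G x / k`!%:R * K l) =
     k`!%:R^-1 * ((- h) ^+ k *
       \sum_(J : k.-tuple 'I_d) moment K J * iter_partial J G x).
    rewrite -(integral_kernel_directional k G x h).2 -RintegralZl//; last first.
      exact: (integral_kernel_directional k G x h).1.
    by apply: eq_Rintegral => l _; ring.
  under eq_bigr do rewrite E.
  case: p p0 Kp dG Gd T iT => [//|p] _ Kp dG Gd _ _.
  rewrite big_ord_recl big_ord_recr/= [X in _ + (X + _)]big1 => [|k _]; last first.
    rewrite [X in _ * (_ * X)]big1 ?mulr0// => J _.
    by rewrite (Kp (lift ord0 (widen_ord (leqnSn p) k))) ?mul0r// /bump/= ltnS ltn_ord.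
  rewrite fact0 invr1 mul1r expr0 mul1r add0r; congr (_ + _).
    rewrite (bigD1 [tuple])//= [X in _ + X]big1 ?addr0.
      rewrite /moment (_ : (fun l => _) = K) ?K1 ?mul1r//.
      by apply/funext => l; rewrite big_nil mul1r.
    by move=> J /eqP[]; exact: tuple0.
  have ac (a b c s : R) : a * (b * c * s) = c * (b * a * s) by ring.
  by rewrite [(- h) ^+ _]exprNn; exact: ac.
have cG : continuous G by move=> y; apply/differentiable_continuous/(dG [::]).
have iG : leb.-integrable setT (EFin \o (fun l => G (x - h *: l) * K l)).
  apply: integrable_kernel_mul => l.
  apply: continuous_comp; last exact: cG.
  apply: continuousB; first exact: cst_continuous.
  exact: scaler_continuous.
rewrite -TE -RintegralB//.
have iB := integrableB measurableT iG iT.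
apply: (le_trans (le_normr_Rintegral measurableT iB)).
have iaK : leb.-integrable setT (EFin \o (fun l => `|K l|)).
  apply: integrable_norm; apply: integrable_continuous_box; [exact: cK|exact: K0].
rewrite -RintegralZl//; apply: le_Rintegral => //.
- exact: integrable_norm iB.
- exact: (integrableZl measurableT _ iaK).
move=> l _; have [bl|nbl] := pselect (box l);
  last by rewrite K0// !mulr0 subrr normr0 mulr0.
rewrite -mulrBl normrM ler_wpM2r//.
rewrite -scaleNr; apply: directional_taylor => //.
by rewrite normrZ normrN (ger0_norm h0) ler_piMr// box_norm.
Qed.

End kernel_expansion.

(** * Expectations of functions of independent random variables with a density *)

Section density.
Context {R : realType} {d0 : measure_display} {Omega : measurableType d0}.
Variable P : probability Omega R.
Context {d' : measure_display} {T : measurableType d'}.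

Section one_variable.
Variables (mu : {sigma_finite_measure set T -> \bar R}) (X : {RV P >-> T}).
Variable g : T -> R.
Hypothesis Xg : has_density X mu g.

Let mg : measurable_fun setT g. Proof. by case: Xg. Qed.
Let g0 x : 0 <= g x. Proof. by case: Xg => _ /(_ x). Qed.

Lemma integral_density : (\int[mu]_x (g x)%:E = 1)%E.
Proof.
case: Xg => _ _ /(_ setT measurableT) <-.
by rewrite /distribution /pushforward preimage_setT probability_setT.
Qed.

Lemma integrable_density : mu.-integrable setT (EFin \o g).
Proof.
apply/integrableP; split; first exact: measurableT_comp.
under eq_integral do rewrite /= ger0_norm//.
by rewrite integral_density ltry.
Qed.

(** By uniqueness, g is the Radon-Nikodym derivative of the law of X. *)
Lemma ge0_expectation_density (F : T -> \bar R) :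
  measurable_fun setT F -> (forall x, 0 <= F x)%E ->
  (\int[P]_w F (X w) = \int[mu]_x (F x * (g x)%:E))%E.
Proof.
move=> mF F0; pose nu := distribution P X.
have nuE A : measurable A -> nu A = (\int[mu]_(x in A) (g x)%:E)%E.
  by case: Xg => _ _; exact.
have numu : nu `<< mu.
  apply/null_content_dominatesP => A mA muA0; rewrite nuE//.
  apply: null_set_integral => //.
  by apply: measurable_funTS; exact: measurableT_comp.
have gRN : ae_eq mu setT (EFin \o g) (Radon_Nikodym_SigmaFinite.f nu mu).
  apply: integral_ae_eq => //.
  - exact: integrable_density.
  - by apply: measurable_int; exact: Radon_Nikodym_SigmaFinite.f_integrable.
  - by move=> E _ mE; rewrite -nuE//; exact: (Radon_Nikodym_SigmaFinite.f_integral numu mE).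
transitivity (\int[nu]_x F x)%E.
  by rewrite ge0_integral_pushforward.
rewrite -(Radon_Nikodym_SigmaFinite.change_of_variables numu F0)//.
apply: ae_eq_integral => //.
- apply: emeasurable_funM => //.
  by apply: measurable_int; exact: Radon_Nikodym_SigmaFinite.f_integrable.
- by apply: emeasurable_funM => //; exact: measurableT_comp.
- by apply: filterS gRN => x /= gx Tx; rewrite gx.
Qed.

Variables (F : T -> R) (M : R).
Hypotheses (mF : measurable_fun setT F) (FM : {ae mu, forall x, `|F x| <= M}).

Lemma integrable_density_mul : mu.-integrable setT (EFin \o (fun x => F x * g x)).
Proof.
apply/integrableP; split; first by apply: measurableT_comp => //; exact: measurable_funM.
have iMg := integrable_density.
apply: (@le_lt_trans _ _ (\int[mu]_x (`|M|%:E * (g x)%:E))%E); last first.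
  by rewrite integralZl// integral_density mule1 ltry.
apply: ae_ge0_le_integral => //.
- by do 2 apply: measurableT_comp => //; exact: measurable_funM.
- by move=> x _; rewrite mule_ge0// lee_fin.
- by apply: emeasurable_funM => //; exact: measurableT_comp.
- apply: filterS FM => x FxM _.
  rewrite /= lee_fin normrM (ger0_norm (g0 x)) ler_wpM2r//.
  exact: le_trans FxM (ler_norm M).
Qed.

Lemma integrable_comp_density : P.-integrable setT (EFin \o (F \o X)).
Proof.
apply/integrableP; split; first by do 2 apply: measurableT_comp => //.
have /integrableP[_] := integrable_density_mul.
rewrite (_ : (\int[P]_w _)%E = (\int[P]_w (`|(F (X w))%:E|))%E)//.
rewrite (ge0_expectation_density (F := fun x => `|(F x)%:E|%E))//; last first.
  by do 2 apply: measurableT_comp => //.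
move=> h; apply: le_lt_trans h; rewrite le_eqVlt; apply/orP; left; apply/eqP.
by apply: eq_integral => x _; rewrite /= normrM (ger0_norm (g0 x)) EFinM.
Qed.

Lemma expectation_density :
  \int[P]_w F (X w) = \int[mu]_x (F x * g x).
Proof.
rewrite /Rintegral; congr fine.
have mFE : measurable_fun setT (EFin \o F) by exact: measurableT_comp.
rewrite integralE [RHS]integralE.
congr (_ - _)%E.
  rewrite (funepos_comp (EFin \o F) X) ge0_expectation_density//;
    last exact: measurable_funepos.
  apply: eq_integral => x _; rewrite !funeposE/= maxe_pMl ?lee_fin//.
  by rewrite mul0e -EFinM.
rewrite (funeneg_comp (EFin \o F) X) ge0_expectation_density//;
  last exact: measurable_funeneg.
apply: eq_integral => x _; rewrite !funenegE/= maxe_pMl ?lee_fin//.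
by rewrite mul0e -EFinM mulNr.
Qed.

End one_variable.

Lemma independent_pair N (X : 'I_N -> {RV P >-> T}) (a b : 'I_N) (A B : set T) :
  mutually_independent X -> a != b -> measurable A -> measurable B ->
  P (X a @^-1` A `&` X b @^-1` B) = (P (X a @^-1` A) * P (X b @^-1` B))%E.
Proof.
move=> indX ab mA mB.
have := indX [set a; b]%SET (fun i => if i == a then A else B).
rewrite big_setU1 ?inE//= big_set1 eqxx (negPf (_ : b != a)) 1?eq_sym//.
move=> <-; last by move=> i; case: ifP.
congr (P _); apply/seteqP; split=> [w /= [Aw Bw] i /=|w /= AB].
  by rewrite !inE => /orP[]/eqP ->; rewrite ?eqxx// eq_sym (negPf ab).
split.
  by have := AB a; rewrite /= !inE eqxx; exact.
by have := AB b; rewrite /= !inE eqxx orbT eq_sym (negPf ab); exact.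
Qed.

(** The joint law of an independent pair is the product of the two laws, so
    Fubini applies. *)
Lemma expectation_independent (X Y : {RV P >-> T}) (F G : T -> R) :
  (forall A B, measurable A -> measurable B ->
    P (X @^-1` A `&` Y @^-1` B) = (P (X @^-1` A) * P (Y @^-1` B))%E) ->
  measurable_fun setT F -> measurable_fun setT G ->
  P.-integrable setT (EFin \o (F \o X)) -> P.-integrable setT (EFin \o (G \o Y)) ->
  P.-integrable setT (EFin \o (fun w => F (X w) * G (Y w))) /\
  \int[P]_w (F (X w) * G (Y w)) = (\int[P]_w F (X w)) * (\int[P]_w G (Y w)).
Proof.
move=> indXY mF mG iF iG.
pose Z w := (X w, Y w).
have mZ : measurable_fun setT Z by apply/measurable_fun_pair.
pose H (z : T * T) : \bar R := ((F z.1)%:E * (G z.2)%:E)%E.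
have mH : measurable_fun setT H.
  apply: emeasurable_funM.
    by do 2 apply: measurableT_comp => //.
  by do 2 apply: measurableT_comp => //.
pose PX := distribution P X; pose PY := distribution P Y.
pose PZ := pushforward_measure P mZ.
have law A : measurable A -> (PX \x PY)%E A = PZ A.
  apply: product_measure_unique => B C mB mC; exact: indXY.
have iFX : PX.-integrable setT (EFin \o F).
  by apply: integrable_pushforward => //; exact: measurableT_comp.
have iGY : PY.-integrable setT (EFin \o G).
  by apply: integrable_pushforward => //; exact: measurableT_comp.
have iHp : (PX \x PY)%E.-integrable setT H.
  apply/(integrable12ltyP _ _ mH); rewrite /H/=.
  have E x : (\int[PY]_y `|(F x)%:E * (G y)%:E| =
      `|(F x)%:E| * \int[PY]_y `|(G y)%:E|)%E.
    under eq_integral do rewrite abseM.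
    by rewrite ge0_integralZl//; do 2 apply: measurableT_comp => //.
  under eq_integral do rewrite E.
  have /integrableP[_ Foo] := iFX.
  have /integrableP[_ Goo] := iGY.
  rewrite ge0_integralZr//.
  - by rewrite lte_mul_pinfty// ?integral_ge0// ge0_fin_numE// integral_ge0.
  - by do 2 apply: measurableT_comp => //.
  - by rewrite integral_ge0.
have iH : P.-integrable setT (H \o Z).
  apply/integrableP; split; first exact: measurableT_comp.
  have /integrableP[_] := iHp.
  rewrite (eq_measure_integral PZ)/=; last by move=> A mA _; rewrite -law.
  rewrite (ge0_integral_pushforward mZ)//.
  by have : measurable_fun setT (fun z => `|H z|%E) by exact: measurableT_comp.
have HE : EFin \o (fun w => F (X w) * G (Y w)) = H \o Z by [].
rewrite HE; split=> //.
rewrite /Rintegral -fineM; first last.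
- by apply: integrable_fin_num.
- by apply: integrable_fin_num.
congr fine; transitivity (\int[P]_w (H \o Z) w)%E; first by [].
rewrite -(integral_pushforward mZ mH (D := setT))//.
rewrite (eq_measure_integral (PX \x PY)%E); last by move=> A mA _; exact/esym/law.
rewrite -integral12_prod_meas1// /fubini_F /H/=.
under eq_integral do rewrite integralZl//.
rewrite -[(\int[PY]_y _)%E]fineK ?integrable_fin_num//.
rewrite integralZr// fineK ?integrable_fin_num//.
congr (_ * _)%E; rewrite integral_pushforward//; exact: measurableT_comp.
Qed.

(** Independent variables are uncorrelated, so only the diagonal terms of the
    double sum remain. *)
Lemma covariance_independent_sum N (X : 'I_N -> {RV P >-> T}) (F G : T -> R) (c : R) :
  mutually_independent X ->
  measurable_fun setT F -> measurable_fun setT G ->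
  (forall i, P.-integrable setT (EFin \o (F \o X i))) ->
  (forall i, P.-integrable setT (EFin \o (G \o X i))) ->
  (forall i, P.-integrable setT (EFin \o (fun w => F (X i w) * G (X i w)))) ->
  fine (covariance P (fun w => c * \sum_i F (X i w)) (fun w => c * \sum_i G (X i w)))
  = c ^+ 2 * \sum_i (\int[P]_w (F (X i w) * G (X i w)) -
                     (\int[P]_w F (X i w)) * (\int[P]_w G (X i w))).
Proof.
move=> indX mF mG iF iG iFG.
have iS (H : T -> R) : (forall i, P.-integrable setT (EFin \o (H \o X i))) ->
    P.-integrable setT (EFin \o (fun w => \sum_i H (X i w))).
  move=> iH; rewrite (_ : EFin \o _ = fun w => (\sum_i (H (X i w))%:E)%E).
    by apply: integrable_sum => // i _; exact: iH.
  by apply/funext => w; rewrite /= sumEFin.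
have iFGij i j : P.-integrable setT (EFin \o (fun w => F (X i w) * G (X j w))).
  have [<-//|ij] := eqVneq i j.
  have := @expectation_independent (X i) (X j) F G _ mF mG (iF i) (iG j).
  by move=> /(_ (fun A B mA mB => independent_pair indX ij mA mB))[].
have iFGi i : P.-integrable setT (EFin \o (fun w => \sum_j F (X i w) * G (X j w))).
  rewrite (_ : EFin \o _ = fun w => (\sum_j (F (X i w) * G (X j w))%:E)%E).
    by apply: integrable_sum => // j _; exact: iFGij.
  by apply/funext => w; rewrite /= sumEFin.
have SS w : (c * \sum_i F (X i w)) * (c * \sum_i G (X i w)) =
    c ^+ 2 * \sum_i \sum_j F (X i w) * G (X j w).
  rewrite mulrACA -expr2; congr (_ * _); rewrite mulr_suml.
  by apply: eq_bigr => i _; rewrite mulr_sumr.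
have iSS : P.-integrable setT (EFin \o (fun w => \sum_i \sum_j F (X i w) * G (X j w))).
  rewrite (_ : EFin \o _ = fun w => (\sum_i (\sum_j F (X i w) * G (X j w))%:E)%E).
    by apply: integrable_sum => // i _; exact: iFGi.
  by apply/funext => w; rewrite /= sumEFin.
have icS (H : Omega -> R) (e : R) : P.-integrable setT (EFin \o H) ->
    P.-integrable setT (EFin \o (fun w => e * H w)).
  by move=> iH; exact: (integrableZl measurableT _ iH).
have iprod : P.-integrable setT (EFin \o
    (fun w => (c * \sum_i F (X i w)) * (c * \sum_i G (X i w)))).
  by under eq_fun do rewrite SS; exact: icS.
have L1 (H : Omega -> R) : P.-integrable setT (EFin \o H) -> H \in Lfun P 1.
  by move=> iH; apply/Lfun1_integrable.
have iA := icS _ c (iS F iF); have iB := icS _ c (iS G iG).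
have EE (H : Omega -> R) : fine ('E_P[H]) = \int[P]_w H w by rewrite unlock.
rewrite covarianceE; [|exact: L1..].
rewrite fineB ?fineM ?fin_numM ?expectation_fin_num//; [|exact: L1..].
rewrite !EE [X in X - _](_ : _ =
  \int[P]_w (c ^+ 2 * \sum_i \sum_j F (X i w) * G (X j w))); last first.
  by apply: eq_Rintegral => w _; exact: SS.
rewrite RintegralZl//.
rewrite (Rintegral_sum (F := fun i w => \sum_j F (X i w) * G (X j w)))//.
rewrite !RintegralZl ?(Rintegral_sum (F := fun i w => F (X i w)))
  ?(Rintegral_sum (F := fun i w => G (X i w)))//; [|exact: iS..].
rewrite [X in _ - X]mulrACA -expr2 -mulrBr; congr (_ * _).
rewrite mulr_suml -sumrB; apply: eq_bigr => i _.
rewrite (Rintegral_sum (F := fun j w => F (X i w) * G (X j w)))//.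
rewrite mulr_sumr -sumrB (bigD1 i)//= big1 ?addr0// => j ji.
have ij : i != j by rewrite eq_sym.
have := @expectation_independent (X i) (X j) F G _ mF mG (iF i) (iG j).
move=> /(_ (fun A B mA mB => independent_pair indX ij mA mB))[_ ->].
by rewrite subrr.
Qed.

End density.

(** * The estimator for a fixed bandwidth *)

Section measurability_of_partials.
Context {R : realType} {d : nat} {d' : measure_display} {T : measurableType d'}.

(** A partial derivative is the limit of difference quotients along 1 / (k + 1). *)
Lemma measurable_partial (psi : 'rV[R]_d -> T -> R) (j : 'I_d) :
  (forall x, measurable_fun setT (psi x)) ->
  (forall z x, derivable (psi^~ z) x (delta_mx 0 j)) ->
  forall x, measurable_fun setT (fun z => partial j (psi^~ z) x).
Proof.
move=> mpsi dpsi x.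
pose u k : R := k.+1%:R^-1.
apply: (@measurable_fun_cvg _ _ _ _
  (fun k z => (u k)^-1 * (psi (u k *: delta_mx 0 j + x) z - psi x z))).
  by move=> k; apply: measurable_funM => //; exact: measurable_funB.
move=> z _; have /cvg_at_rightP := cvg_dnbhs_at_right (dpsi z x).
apply; split; first by move=> k; rewrite invr_gt0.
exact: cvg_harmonic.
Qed.

Lemma measurable_iter_partial (f : 'rV[R]_d -> T -> R) k :
  (forall x, measurable_fun setT (f x)) ->
  (forall z, times_differentiable k (f^~ z)) ->
  forall J : seq 'I_d, (size J <= k)%N ->
  forall x, measurable_fun setT (fun z => iter_partial J (f^~ z) x).
Proof.
move=> mf df; elim=> [|j J IH] /= Jk x; first exact: mf.
apply: (@measurable_partial (fun y z => iter_partial J (f^~ z) y)).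
  by move=> y; apply: IH; exact: ltnW.
move=> z y; apply: diff_derivable.
exact: (times_differentiable_iter_partial (df z)).
Qed.

End measurability_of_partials.

Section kernel_by_parts.
Context {R : realType} {d : nat}.
Local Notation leb := (lebesgue_rV d : {measure set 'rV[R]_d -> \bar R}).

Lemma affine_shift (x e y : 'rV[R]_d) (h k : R) :
  x - h *: (k *: e + y) = k *: (- h *: e) + (x - h *: y).
Proof. by apply/rowP => i; rewrite !mxE; ring. Qed.

Lemma continuous_affine (x : 'rV[R]_d) (h : R) :
  continuous (fun l : 'rV[R]_d => x - h *: l).
Proof.
by move=> l; apply: continuousB; [exact: cst_continuous|exact: scaler_continuous].
Qed.

Lemma continuous_comp_affine (G : 'rV[R]_d -> R) (x : 'rV[R]_d) (h : R) :
  continuous G -> continuous (fun l : 'rV[R]_d => G (x - h *: l)).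
Proof.
move=> cG l; apply: (@continuous_comp _ _ _ (fun l : 'rV[R]_d => x - h *: l) G).
  exact: continuous_affine.
exact: cG.
Qed.

Lemma derive_affine (G : 'rV[R]_d -> R) (x : 'rV[R]_d) (h : R) (j : 'I_d) l :
  differentiable G (x - h *: l) ->
  is_derive l (delta_mx 0 j) (fun l : 'rV[R]_d => G (x - h *: l))
    (- h * partial j G (x - h *: l)).
Proof.
move=> dG.
have [h1 h2] := derive_comp_affine G (s := fun l : 'rV[R]_d => x - h *: l)
  (affine_shift x (delta_mx 0 j) l h).
split; first exact/h2/diff_derivable.
by rewrite h1 deriveE// linearZ/= -deriveE.
Qed.

(** This moves the derivative from K to G. The factor h it produces turns the
    normalization h^(d+1) of the estimator into the h^d of a kernel smoothing of
    the partial derivative of G. *)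
Lemma kernel_by_parts (K G : 'rV[R]_d -> R) (j : 'I_d) (x : 'rV[R]_d) (h : R) :
  continuously_differentiable K -> (forall l, ~ box l -> K l = 0) ->
  (forall y, differentiable G y) -> continuous (partial j G) ->
  \int[leb]_l (G (x - h *: l) * partial j K l) =
  h * \int[leb]_l (partial j G (x - h *: l) * K l).
Proof.
move=> [dK cdK] K0 dG cdG.
have dK0 := partial_outside_box j K0.
have cK : continuous K by move=> y; exact: differentiable_continuous.
have cG : continuous G by move=> y; exact: differentiable_continuous.
pose Gx (l : 'rV[R]_d) := G (x - h *: l).
have cGx : continuous Gx by exact: continuous_comp_affine.
have cdGx := continuous_comp_affine cdG (x := x) (h := h).
have iGK : leb.-integrable setT (EFin \o (fun l : 'rV[R]_d => Gx l * partial j K l)).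
  apply: integrable_kernel_mul => //; exact: cdK.
have iGK' : leb.-integrable setT
    (EFin \o (fun l : 'rV[R]_d => partial j G (x - h *: l) * K l)).
  exact: integrable_kernel_mul.
have pE l : partial j (Gx * K) l =
    Gx l * partial j K l - h * (partial j G (x - h *: l) * K l).
  have dGx := derive_affine j (dG (x - h *: l)).
  have dKl : is_derive l (delta_mx 0 j) K (partial j K l).
    by split => //; exact: diff_derivable.
  have [_] := is_deriveM dGx dKl.
  by rewrite /partial /Gx => ->; rewrite /GRing.scale/=; ring.
have P0 : (\int[leb]_l (partial j (Gx * K) l)%:E = 0)%E.
  apply: integral_partial0.
  - move=> l; have [+ _] := derive_affine j (dG (x - h *: l)).
    by move=> dGx; apply: derivableM => //; exact: diff_derivable.
  - rewrite (_ : partial j (Gx * K) = (fun l : 'rV[R]_d => Gx l * partial j K l) -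
        (fun l : 'rV[R]_d => h * (partial j G (x - h *: l) * K l))); last exact/funext.
    move=> l; apply: continuousB; first by apply: continuousM; [exact: cGx|exact: cdK].
    apply: continuousM; first exact: cst_continuous.
    by apply: continuousM; [exact: cdGx|exact: cK].
  - by move=> l nbl; rewrite /= /GRing.mul/= K0// mulr0.
have : \int[leb]_l (Gx l * partial j K l - h * (partial j G (x - h *: l) * K l)) = 0.
  transitivity (fine (\int[leb]_l (partial j (Gx * K) l)%:E)); last by rewrite P0.
  by congr fine; apply: eq_integral => l _; rewrite pE.
rewrite RintegralB//; last exact: (integrableZl measurableT _ iGK').
by rewrite RintegralZl// => /eqP; rewrite subr_eq0 => /eqP.
Qed.

End kernel_by_parts.

(** The Radon-Nikodym theorem behind ge0_expectation_density is applied to the law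
    of a pair, which asks for a sigma-finite reference measure on the product. *)
Definition product_sigma_finite {R : realType} d1 d2 (T1 : measurableType d1)
    (T2 : measurableType d2) (m1 : {sigma_finite_measure set T1 -> \bar R})
    (m2 : {sigma_finite_measure set T2 -> \bar R}) :
    {sigma_finite_measure set (T1 * T2)%type -> \bar R} :=
  HB.pack (product_measure1 m1 m2)
    (lebesgue_integral_fubini.measure_function_Measure_isSigmaFinite__to__measure_function_isSigmaFinite m1 m2)
    (lebesgue_integral_fubini.measure_function_Measure_isSigmaFinite__to__measure_function_isSFinite m1 m2).

Lemma integrable_fubini_G {R : realType} d1 d2 (T1 : measurableType d1)
    (T2 : measurableType d2) (m1 : {sigma_finite_measure set T1 -> \bar R})
    (m2 : {sigma_finite_measure set T2 -> \bar R}) (F : T1 * T2 -> \bar R) :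
  (m1 \x m2)%E.-integrable setT F -> m2.-integrable setT (fubini_G m1 F).
Proof.
move=> iF; have mF := measurable_int _ iF.
apply/integrableP; split; first exact: (measurable_fubini_G iF).
apply: le_lt_trans ((integrable21ltyP _ _ mF).1 iF).
apply: ge0_le_integral => //.
- by apply: measurableT_comp => //; exact: (measurable_fubini_G iF).
- apply: (measurable_fun_fubini_tonelli_G (abse \o F)) => [|y].
    exact: measurableT_comp.
  exact: abse_ge0.
- by move=> y _; apply: le_abse_integral => //; exact: measurableT_comp.
Qed.

Section kernel_expectation.
Context {R : realType} {d n : nat} {d0 : measure_display} {Omega : measurableType d0}.
Local Notation leb k := (lebesgue_rV k : {measure set 'rV[R]_k -> \bar R}).
Variable P : probability Omega R.
Variables (f : 'rV[R]_d -> 'rV[R]_n -> R) (lam0 : 'rV[R]_d) (h eps : R).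
Hypotheses (h0 : 0 < h) (heps : h <= eps).
Hypothesis cf : forall z, continuous (f^~ z).
Variable X : {RV P >-> ('rV[R]_d * 'rV[R]_n)%type}.
Hypothesis Xf : has_density X (product_measure1 (lebesgue_rV d) (lebesgue_rV n))
  (joint_density f lam0 eps).
Variables (psi : 'rV[R]_n -> R) (M : R) (D : 'rV[R]_d -> R).
Hypotheses (mpsi : measurable_fun setT psi)
  (psiM : {ae leb n, forall z, `|psi z| <= M}).
Hypotheses (cD : continuous D) (D0 : forall l, ~ box l -> D l = 0).
Hypothesis ipsif : forall lam, (leb n).-integrable setT (EFin \o (fun z => psi z * f lam z)).

Definition weighted_kernel (x : 'rV[R]_d * 'rV[R]_n) : R :=
  psi x.2 * D (h^-1 *: (lam0 - x.1)).

Lemma ae_snd d1 d2 (T1 : measurableType d1) (T2 : measurableType d2)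
    (m1 : {sigma_finite_measure set T1 -> \bar R})
    (m2 : {sigma_finite_measure set T2 -> \bar R}) (Q : T2 -> Prop) :
  {ae m2, forall y, Q y} -> {ae (m1 \x m2)%E, forall x, Q x.2}.
Proof.
move=> [A [mA A0 QA]]; exists (setT `*` A); split.
- exact: measurableX.
- by rewrite product_measure1E// A0 mule0.
- by move=> [x y] /= nQ; split => //; exact: QA.
Qed.

Let h_neq0 : h != 0. Proof. by rewrite gt_eqF. Qed.

Let rescale l : h^-1 *: (lam0 - (lam0 - h *: l)) = l.
Proof. by rewrite opprB addrCA subrr addr0 scalerA mulVf// scale1r. Qed.

Let continuous_rescaled : continuous (fun lam : 'rV[R]_d => D (h^-1 *: (lam0 - lam))).
Proof.
have E lam : h^-1 *: (lam0 - lam) = h^-1 *: lam0 - h^-1 *: lam by rewrite scalerBr.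
under eq_fun do rewrite E; exact: continuous_comp_affine.
Qed.

Let mu2 := product_sigma_finite (@lebesgue_rV R d) (@lebesgue_rV R n).

Let Xf2 : has_density X mu2 (joint_density f lam0 eps). Proof. exact: Xf. Qed.

Lemma measurable_weighted_kernel : measurable_fun setT weighted_kernel.
Proof.
apply: measurable_funM; first exact: measurableT_comp.
apply: (measurableT_comp (f := fun lam : 'rV[R]_d => D (h^-1 *: (lam0 - lam)))) => //.
exact: continuous_measurable_rV continuous_rescaled.
Qed.

Lemma ae_bounded_weighted_kernel :
  exists M', {ae mu2,
    forall x, `|weighted_kernel x| <= M'}.
Proof.
have [MD MD0 DM] := bounded_on_box cD D0.
exists (M * MD); have := ae_snd (lebesgue_rV d) psiM.
apply: filterS => x psix; rewrite /weighted_kernel normrM.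
by rewrite ler_pM.
Qed.

(** The box of half-width eps >= h contains the support of the rescaled kernel, on
    which the randomizing density is therefore constant. *)
Let kernel_ell lam :
  D (h^-1 *: (lam0 - lam)) * ell eps (lam0 - lam) =
  ((2 * eps) ^+ d)^-1 * D (h^-1 *: (lam0 - lam)).
Proof.
rewrite /ell mulrCA mulrA; set l := h^-1 *: _.
have [bl|nbl] := pselect (box l); last by rewrite D0// !(mulr0, mul0r).
rewrite indicE mem_set ?mulr1//= => i.
have := bl i; rewrite !mxE ler_pdivlMl// ler_pdivrMl// mulrN1 mulr1 => /andP[h1 h2].
by rewrite (le_trans _ h1) ?lerN2//= (le_trans h2).
Qed.

Let H (x : 'rV[R]_d * 'rV[R]_n) : R :=
  psi x.2 * (D (h^-1 *: (lam0 - x.1)) * f x.1 x.2).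

Let weighted_kernel_joint x :
  weighted_kernel x * joint_density f lam0 eps x = ((2 * eps) ^+ d)^-1 * H x.
Proof.
rewrite /weighted_kernel /joint_density /H.
transitivity (psi x.2 * (D (h^-1 *: (lam0 - x.1)) * ell eps (lam0 - x.1)) * f x.1 x.2).
  by ring.
by rewrite kernel_ell; ring.
Qed.

Let eps2_neq0 : (2 * eps) ^+ d != 0.
Proof. by rewrite expf_neq0// gt_eqF// mulr_gt0// (lt_le_trans h0). Qed.

Lemma integrable_weighted_kernel : P.-integrable setT (EFin \o (weighted_kernel \o X)).
Proof.
have [M' WM] := ae_bounded_weighted_kernel.
exact: (@integrable_comp_density _ _ _ P _ _ mu2 X _ Xf2 _ _ measurable_weighted_kernel WM).
Qed.

Let iH : (lebesgue_rV d \x lebesgue_rV n)%E.-integrable setT (EFin \o H).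
Proof.
have [M' WM] := ae_bounded_weighted_kernel.
have iWf := integrable_density_mul Xf2 measurable_weighted_kernel WM.
rewrite (_ : EFin \o H = fun x => (((2 * eps) ^+ d)%:E *
  (weighted_kernel x * joint_density f lam0 eps x)%:E)%E).
  exact: integrableZl.
apply/funext => x; rewrite /= weighted_kernel_joint -EFinM; congr EFin.
by rewrite mulrA mulfV// mul1r.
Qed.

Let expectationH : \int[P]_w weighted_kernel (X w) =
  ((2 * eps) ^+ d)^-1 * fine (\int[(lebesgue_rV d \x lebesgue_rV n)%E]_x (H x)%:E).
Proof.
have [M' WM] := ae_bounded_weighted_kernel.
rewrite (expectation_density Xf2 measurable_weighted_kernel).
under eq_Rintegral do rewrite weighted_kernel_joint.
by rewrite RintegralZl.
Qed.

Let Fz z (l : 'rV[R]_d) := f (lam0 - h *: l) z * D l.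

Let iFz z : (leb d).-integrable setT (EFin \o Fz z).
Proof. by apply: integrable_kernel_mul => //; exact: (@continuous_comp_affine _ _ (f^~ z)). Qed.

Let FzE z lam : D (h^-1 *: (lam0 - lam)) * f lam z = Fz z (h^-1 *: lam0 - h^-1 *: lam).
Proof. by rewrite /Fz -scalerBr scalerA mulfV// scale1r opprB addrCA subrr addr0 mulrC. Qed.

(** Integrating lam first isolates, for each z, a kernel smoothing of f(., z). This
    form gives the mean. *)
Lemma expectation_kernel_inner_lam :
  (leb n).-integrable setT
    (EFin \o (fun z => psi z * \int[leb d]_l (f (lam0 - h *: l) z * D l))) /\
  \int[P]_w weighted_kernel (X w) = (h / (2 * eps)) ^+ d *
    \int[leb n]_z (psi z * \int[leb d]_l (f (lam0 - h *: l) z * D l)).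
Proof.
have hV0 : 0 < h^-1 by rewrite invr_gt0.
have GE : fubini_G (lebesgue_rV d) (EFin \o H) =
    (fun z => ((h ^+ d)%:E * (psi z * \int[leb d]_l (f (lam0 - h *: l) z * D l))%:E)%E).
  apply/funext => z; rewrite /fubini_G/= /H/=.
  have iz := integrable_affine (h^-1 *: lam0) hV0 (iFz z).
  under eq_integral do rewrite FzE EFinM.
  rewrite integralZl// -[(\int[_]_ _ _)%E in LHS]fineK ?integrable_fin_num//.
  rewrite -!EFinM; congr EFin; rewrite mulrCA; congr (_ * _).
  rewrite -/(Rintegral _ _ _) (Rintegral_affine (h^-1 *: lam0) hV0 (iFz z)).
  by rewrite exprVn mulrA mulfV ?mul1r// expf_neq0.
have iG := integrable_fubini_G iH; rewrite GE in iG.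
have hd0 : h ^+ d != 0 by rewrite expf_neq0.
have iG' : (leb n).-integrable setT
    (EFin \o (fun z => psi z * \int[leb d]_l (f (lam0 - h *: l) z * D l))).
  have := integrableZl measurableT (h ^+ d)^-1 iG.
  apply: eq_integrable => // z _.
  by rewrite /= -!EFinM mulrA mulVf// mul1r.
split=> //; rewrite expectationH -integral21_prod_meas1// GE integralZl//.
rewrite fineM//; last exact: integrable_fin_num.
by rewrite mulrA expr_div_n (mulrC _^-1).
Qed.

(** Integrating z first leaves a kernel smoothing of the map that sends lam to the
    integral of psi f(lam, .). This form gives the second moments, where no
    derivative of that map is involved. *)
Lemma expectation_kernel_inner_z :
  (leb d).-integrable setT
    (EFin \o (fun l : 'rV[R]_d => (\int[leb n]_z (psi z * f (lam0 - h *: l) z)) * D l)) /\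
  \int[P]_w weighted_kernel (X w) = (h / (2 * eps)) ^+ d *
    \int[leb d]_l ((\int[leb n]_z (psi z * f (lam0 - h *: l) z)) * D l).
Proof.
pose W lam := \int[leb n]_z (psi z * f lam z).
have FE : fubini_F (lebesgue_rV n) (EFin \o H) =
    EFin \o (fun lam : 'rV[R]_d => W lam * D (h^-1 *: (lam0 - lam))).
  apply/funext => lam; rewrite /fubini_F/= /H/=.
  under eq_integral do rewrite mulrCA EFinM.
  rewrite integralZl//; last exact: ipsif.
  rewrite EFinM muleC fineK//; apply: integrable_fin_num => //; exact: ipsif.
have iF := integrable_fubini_F iH; rewrite FE in iF.
have EF : (fun l : 'rV[R]_d =>
      (fun lam : 'rV[R]_d => W lam * D (h^-1 *: (lam0 - lam))) (lam0 - h *: l)) =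
    (fun l : 'rV[R]_d => W (lam0 - h *: l) * D l).
  by apply/funext => l; rewrite rescale.
have := integrable_affine lam0 h0 iF; rewrite EF => iF'.
split=> //; rewrite expectationH -integral12_prod_meas1// FE.
rewrite -/(Rintegral _ _ _) (Rintegral_affine lam0 h0 iF) EF.
by rewrite mulrA expr_div_n (mulrC _^-1).
Qed.

End kernel_expectation.

(** * Continuity in mean of the densities *)

Section scheffe.
Context {R : realType} {d' : measure_display} {T : measurableType d'}.
Variable mu : {measure set T -> \bar R}.

Lemma dominated_Rintegral0 (u : nat -> T -> R) (g : T -> R) :
  (forall k, measurable_fun setT (u k)) -> (forall x, u ^~ x @ \oo --> (0 : R)) ->
  mu.-integrable setT (EFin \o g) -> (forall k x, `|u k x| <= g x) ->
  (fun k => \int[mu]_x u k x) @ \oo --> (0 : R).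
Proof.
move=> mu_ u0 ig ug.
have := @dominated_cvg _ _ _ mu _ measurableT (fun k x => (u k x)%:E)
  (cst 0%E) (EFin \o g).
rewrite integral0 => H; apply: (@fine_cvg _ _ _ _ _ 0); apply: H => //.
- by move=> k; exact: measurableT_comp.
- by move=> x _; apply: cvg_EFin; [exact: nearW|exact: u0].
- by move=> k x _; rewrite /= lee_fin.
Qed.

(** Since the u_k have the same integral as g, the positive and negative parts
    of g - u_k have equal integrals, and the positive part is dominated by g. *)
Lemma scheffe (u : nat -> T -> R) (g : T -> R) :
  (forall k x, 0 <= u k x) -> (forall x, 0 <= g x) ->
  (forall k, mu.-integrable setT (EFin \o u k)) -> mu.-integrable setT (EFin \o g) ->
  (forall k, \int[mu]_x u k x = \int[mu]_x g x) ->
  (forall x, u ^~ x @ \oo --> g x) ->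
  (fun k => \int[mu]_x `|u k x - g x|) @ \oo --> (0 : R).
Proof.
move=> u0 g0 iu ig ug cu.
have mg : measurable_fun setT g by apply/measurable_EFinP; exact: measurable_int ig.
have mu_ k : measurable_fun setT (u k).
  by apply/measurable_EFinP; exact: measurable_int (iu k).
pose v k x := Num.max (g x - u k x) 0.
have mv k : measurable_fun setT (v k).
  by apply: measurable_maxr => //; exact: measurable_funB.
have vg k x : `|v k x| <= g x.
  rewrite ger0_norm; last by rewrite /v le_max lexx orbT.
  by rewrite /v ge_max g0 andbT lerBlDr lerDl.
have iv k : mu.-integrable setT (EFin \o v k).
  apply: le_integrable ig => //; first exact: measurableT_comp.
  by move=> x _; rewrite /= lee_fin (ger0_norm (g0 x)).
have v0 x : v ^~ x @ \oo --> (0 : R).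
  apply/cvgrPdist_le => e e0; near=> k.
  apply: (@le_trans _ _ `|g x - u k x|); last first.
    by near: k; exact: cvgr_dist_le (cu x) _ e0.
  rewrite sub0r normrN /v; have [_|_] := leP (g x - u k x) 0 => //.
  by rewrite normr0.
have := dominated_Rintegral0 mv v0 ig vg.
rewrite (_ : (fun k => \int[mu]_x `|u k x - g x|) = (fun k => 2 * \int[mu]_x v k x)).
  move=> H; rewrite -[X in _ --> X](mulr0 2).
  by apply: cvgM => //; exact: cvg_cst.
apply/funext => k.
have E x : `|u k x - g x| = (u k x - g x) + 2 * v k x.
  rewrite /v; have [ug0|gu0] := leP (g x - u k x) 0.
    by rewrite mulr0 addr0 ger0_norm//; lra.
  by rewrite ltr0_norm; lra.
under eq_Rintegral do rewrite E.
rewrite RintegralD//; [|exact: (integrableB measurableT (iu k) ig)|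
  exact: (integrableZl measurableT _ (iv k))].
by rewrite RintegralB// ug subrr add0r RintegralZl.
Unshelve. all: end_near. Qed.

Lemma le_Rintegral_ae_bounded (psi g : T -> R) (M : R) :
  measurable_fun setT psi -> {ae mu, forall x, `|psi x| <= M} ->
  mu.-integrable setT (EFin \o g) ->
  mu.-integrable setT (EFin \o (fun x => psi x * g x)) /\
  `|\int[mu]_x (psi x * g x)| <= `|M| * \int[mu]_x `|g x|.
Proof.
move=> mpsi psiM ig.
have mg : measurable_fun setT g by apply/measurable_EFinP; exact: measurable_int ig.
have ing := integrable_norm ig.
have le : (\int[mu]_x `|(psi x * g x)%:E| <= \int[mu]_x (`|M|%:E * (`|g x|)%:E))%E.
  apply: ae_ge0_le_integral => //.
  - by do 2 apply: measurableT_comp => //; exact: measurable_funM.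
  - by apply/measurable_EFinP; apply: measurable_funM => //; exact: measurableT_comp.
  - apply: filterS psiM => x psix _; rewrite /= lee_fin normrM ler_wpM2r//.
    exact: le_trans psix (ler_norm M).
have iMg : (\int[mu]_x (`|M|%:E * (`|g x|)%:E) = (`|M| * \int[mu]_x `|g x|)%:E)%E.
  by rewrite integralZl// EFinM fineK//; exact: integrable_fin_num.
rewrite iMg in le.
have ipg : mu.-integrable setT (EFin \o (fun x => psi x * g x)).
  apply/integrableP; split; first by apply: measurableT_comp => //; exact: measurable_funM.
  by apply: le_lt_trans le _; rewrite ltry.
split=> //; apply: le_trans (le_normr_Rintegral measurableT ipg) _.
rewrite -lee_fin; apply: le_trans le; rewrite fineK//.
by apply: integrable_fin_num => //; exact: integrable_norm.
Qed.

(** By Scheffe's lemma, pointwise continuity of a family of probability densities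
    makes it continuous in L^1, hence also when integrated against a bounded psi. *)
Lemma density_integral_continuous (V : normedModType R) (f : V -> T -> R) (x0 : V)
    (psi : T -> R) (M : R) :
  (forall x z, 0 <= f x z) -> (forall x, mu.-integrable setT (EFin \o f x)) ->
  (forall x, \int[mu]_z f x z = 1) -> (forall z, {for x0, continuous (f^~ z)}) ->
  measurable_fun setT psi -> {ae mu, forall z, `|psi z| <= M} ->
  (fun x => \int[mu]_z (psi z * f x z)) @ x0 --> \int[mu]_z (psi z * f x0 z).
Proof.
move=> f0 iF f1 cf mpsi psiM.
(* The dominated convergence behind Scheffe's lemma is sequential: a failure of
   the limit at x0 would occur along some sequence u converging to x0. *)
apply/(@cvgrPdist_lt _ _ _ _ (nbhs_filter x0)) => e e0.
pose W x := \int[mu]_z (psi z * f x z).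
apply: contrapT => nW.
have far k : exists x, ball x0 k.+1%:R^-1 x /\ ~ (`|W x0 - W x| < e).
  apply: contrapT => nk; apply: nW; apply/nbhs_ballP.
  exists k.+1%:R^-1; first by rewrite /= invr_gt0.
  move=> x bx; apply: contrapT => nx; apply: nk; exists x; split=> //.
have /choice[u uP] := far.
have u0 : u @ \oo --> x0.
  apply/cvgrPdist_lt => r r0; near=> k.
  have [+ _] := uP k; rewrite -ball_normE /= => /lt_le_trans; apply; apply/ltW.
  by near: k; exact: (near_infty_natSinv_lt (PosNum r0)).
have L1 : (fun k => \int[mu]_z `|f (u k) z - f x0 z|) @ \oo --> (0 : R).
  apply: scheffe => // [k|z]; first by rewrite !f1.
  exact: (cvg_comp u (f^~ z) u0 (cf z)).
have : \forall k \near \oo, `|M| * \int[mu]_z `|f (u k) z - f x0 z| < e.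
  have ML1 : (fun k => `|M| * \int[mu]_z `|f (u k) z - f x0 z|) @ \oo --> (0 : R).
    by rewrite -[X in _ --> X](mulr0 `|M|); apply: cvgM => //; exact: cvg_cst.
  exact: (cvgr_lt _ ML1).
move=> [k _ /(_ k (leqnn k)) kP].
apply: (uP k).2; apply: le_lt_trans kP.
have iB := integrableB measurableT (iF (u k)) (iF x0).
have [i1 _] := le_Rintegral_ae_bounded mpsi psiM (iF (u k)).
have [i2 _] := le_Rintegral_ae_bounded mpsi psiM (iF x0).
have [_] := le_Rintegral_ae_bounded mpsi psiM iB.
rewrite distrC /W -RintegralB//; under eq_Rintegral do rewrite mulrBr.
exact.
Unshelve. all: end_near. Qed.

End scheffe.

(** * The bias *)

Section bias.
Context {R : realType} {d n : nat}.
Local Notation leb k := (lebesgue_rV k : {measure set 'rV[R]_k -> \bar R}).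
Variables (phi : 'rV[R]_n -> R) (f : 'rV[R]_d -> 'rV[R]_n -> R).
Variables (lam0 : 'rV[R]_d) (K : 'rV[R]_d -> R) (p : nat).
Hypotheses (mphi : measurable_fun setT phi)
  (mf : forall lam, measurable_fun setT (f lam)).
Hypotheses (AK : assumption_K K p) (K0 : forall l, ~ box l -> K l = 0).
Hypotheses (R3 : assumption_R3 phi f lam0 p) (dom : dominated_increments phi f lam0 p).

Definition smoothed_partial (j : 'I_d) (h : R) (z : 'rV[R]_n) : R :=
  \int[leb d]_l (partial j (f^~ z) (lam0 - h *: l) * K l).

Let df j z := partial j (f^~ z) lam0.
Let X j z := xi K p (fun lam z => partial j (f^~ z) lam) lam0 z.
Let Q j h z := phi z * smoothed_partial j h z.
Let A j h z := phi z * (df j z + h ^+ p * X j z).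

Hypothesis iQ : forall j h, 0 < h -> (leb n).-integrable setT (EFin \o Q j h).

Let C := (d ^ p)%:R * \int[leb d]_l `|K l|.

Let C0 : 0 <= C. Proof. by rewrite mulr_ge0// Rintegral_ge0. Qed.

Let cK : continuous K.
Proof. by move=> l; case: AK => [[dK _] _ _ _ _]; exact: differentiable_continuous. Qed.

(** With G = partial j (f^~ z), the p-th partials of G are (p+1)-st partials of f,
    with j in the last position. *)
Lemma remainder_pointwise j z h delta : 0 <= h -> 0 <= delta ->
  (forall (J : p.+1.-tuple 'I_d) w, `|w| <= h ->
    `|iter_partial J (f^~ z) (lam0 + w) - iter_partial J (f^~ z) lam0| <= delta) ->
  `|Q j h z - A j h z| <= C * h ^+ p * (`|phi z| * delta).
Proof.
move=> h0 delta0 fd; rewrite /Q /A -mulrBr normrM [leRHS]mulrCA ler_wpM2l//.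
have [[_ _] _ K1 [p0 _ Kp] p2] := AK.
rewrite /C (_ : _ * delta = (d ^ p)%:R * h ^+ p * delta * \int[leb d]_l `|K l|); last by ring.
apply: kernel_expansion => //.
- move=> J Jp y; rewrite -iter_partial_rcons.
  by apply: (times_differentiable_iter_partial (R3.1 z)); rewrite size_rcons ltnS.
- by move=> J w wh; rewrite -!iter_partial_rcons; exact: (fd [tuple of rcons J j]).
Qed.

(** The dominating function of the increments, divided by |phi z|, bounds them at
    each z where phi does not vanish. *)
Let remainder_dominated : exists2 g : 'rV[R]_n -> R,
    (leb n).-integrable setT (EFin \o g) &
  exists2 r, 0 < r & forall h, 0 <= h -> h < r -> forall j z,
    0 <= g z /\ `|Q j h z - A j h z| <= C * h ^+ p * g z.
Proof.
have [g ig /nbhs_ballP[r r0 gP]] := dom; exists g => //; exists r => // h h0 hr j z.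
have near_lam0 w : `|w| <= h -> ball lam0 r (lam0 + w).
  move=> wh; rewrite -ball_normE /= opprD addrA subrr sub0r normrN.
  exact: le_lt_trans hr.
have gz : 0 <= g z.
  apply: le_trans (gP lam0 (ballxx _ r0) [tuple of nseq p.+1 j] z).
  by rewrite mulr_ge0.
split => //; have [phi0|phi0] := eqVneq (phi z) 0.
  rewrite /Q /A phi0 !mul0r subrr normr0; apply: mulr_ge0 => //.
  by apply: mulr_ge0; [exact: C0|exact: exprn_ge0].
have phiz : 0 < `|phi z| by rewrite normr_gt0.
have -> : g z = `|phi z| * (g z / `|phi z|) by rewrite mulrC divfK// gt_eqF.
apply: remainder_pointwise => //; first by rewrite divr_ge0.
by move=> J w /near_lam0 wr; rewrite ler_pdivlMr// mulrC; exact: gP.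
Qed.

(** On the support of phi the increments are also small uniformly in z. *)
Let remainder_uniform e : 0 < e -> exists2 r, 0 < r &
  forall h, 0 <= h -> h < r -> forall j z, `|Q j h z - A j h z| <= C * h ^+ p * (`|phi z| * e).
Proof.
move=> e0; have [_ [S phiS fS]] := R3.
have /filter_forall : forall J : p.+1.-tuple 'I_d, \forall lam \near lam0,
    forall z, S z -> `|iter_partial J (f^~ z) lam - iter_partial J (f^~ z) lam0| < e.
  by move=> J; exact: fS.
move=> /nbhs_ballP[r r0 fr]; exists r => // h h0 hr j z.
have [phi0|phi0] := eqVneq (phi z) 0.
  by rewrite /Q /A phi0 !mul0r subrr normr0 mul0r mulr0.
have Sz : S z by apply: interior_subset; apply: phiS; exact: subset_closure.
apply: remainder_pointwise => //; first exact: ltW.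
move=> J w wh; apply/ltW/fr => //; rewrite -ball_normE /= opprD addrA subrr sub0r normrN.
exact: le_lt_trans hr.
Qed.

Let mdf j : measurable_fun setT (df j).
Proof. exact: (measurable_iter_partial mf R3.1 (J := [:: j])). Qed.

Let mX j : measurable_fun setT (X j).
Proof.
apply: measurable_funM => //; apply: measurable_sum => J.
apply: measurable_funM => //.
have := measurable_iter_partial mf R3.1 (J := rcons J j).
rewrite size_rcons size_tuple => /(_ (leqnn _) lam0).
by under eq_fun do rewrite iter_partial_rcons.
Qed.

Let mA j h : measurable_fun setT (A j h).
Proof.
apply: measurable_funM => //; apply: measurable_funD => //.
exact: measurable_funM.
Qed.

Let integrable_main_part : exists2 r, 0 < r & forall h, 0 < h -> h < r -> forall j,
  (leb n).-integrable setT (EFin \o A j h).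
Proof.
have [g ig [r r0 gP]] := remainder_dominated; exists r => // h h0 hr j.
have iR : (leb n).-integrable setT (EFin \o (fun z => Q j h z - A j h z)).
  apply: (le_integrable measurableT _ _ (integrableZl measurableT (C * h ^+ p) ig)).
    apply: measurableT_comp => //; apply: measurable_funB => //.
    by apply/measurable_EFinP; exact: measurable_int (iQ j h0).
  move=> z _; have [gz QA] := gP h (ltW h0) hr j z.
  by rewrite /= lee_fin (le_trans QA)// ler_norm.
have := integrableB measurableT (iQ j h0) iR.
by apply: eq_integrable => // z _; rewrite /= -EFinB opprB addrCA subrr addr0.
Qed.

(** phi df + h^p phi X is integrable for every small h; two values of h separate
    the two terms. *)
Let iX j : (leb n).-integrable setT (EFin \o (fun z => X j z * phi z)).
Proof.
have [r r0 iA] := integrable_main_part.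
have p0 : (0 < p)%N by case: AK => _ _ _ [].
pose h1 := r / 2; pose h2 := r / 3.
have [h10 h20] : 0 < h1 /\ 0 < h2 by rewrite /h1 /h2; split; lra.
have [h1r h2r] : h1 < r /\ h2 < r by rewrite /h1 /h2; split; lra.
have h12 : h1 ^+ p - h2 ^+ p != 0.
  have h21 : h2 < h1 by rewrite /h1 /h2; lra.
  by rewrite subr_eq0 gt_eqF// ltrXn2r -?lt0n// ltW.
have iB := integrableB measurableT (iA h1 h10 h1r j) (iA h2 h20 h2r j).
have := integrableZl measurableT (h1 ^+ p - h2 ^+ p)^-1 iB.
apply: eq_integrable => // z _; rewrite /= -EFinB -EFinM; congr EFin.
have -> : A j h1 z - A j h2 z = (h1 ^+ p - h2 ^+ p) * (X j z * phi z).
  by rewrite /A; move: (X j z) (df j z) => x y; ring.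
by rewrite mulrA mulVf// mul1r.
Qed.

Let idf j : (leb n).-integrable setT (EFin \o (fun z => phi z * df j z)).
Proof.
have [r r0 iA] := integrable_main_part.
have [h10 h1r] : 0 < r / 2 /\ r / 2 < r by split; lra.
have := integrableB measurableT (iA _ h10 h1r j)
  (integrableZl measurableT ((r / 2) ^+ p) (iX j)).
apply: eq_integrable => // z _; rewrite /= -EFinB; congr EFin.
by rewrite /A; move: (X j z) (df j z) => x y; ring.
Qed.

(** For h small, phi times the remainder is at most C h^p min(g, e |phi|); the
    integral of this minimum vanishes with e by dominated convergence. *)
Lemma bias_expansion j eta : 0 < eta -> exists2 r, 0 < r & forall h, 0 < h -> h < r ->
  `|\int[leb n]_z (phi z * smoothed_partial j h z) -
    (\int[leb n]_z (phi z * partial j (f^~ z) lam0) +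
     h ^+ p * \int[leb n]_z (X j z * phi z))| <= eta * h ^+ p.
Proof.
move=> eta0; have [g ig [r0 r00 gP]] := remainder_dominated.
have mg : measurable_fun setT g by apply/measurable_EFinP; exact: measurable_int ig.
have g0 z : 0 <= g z by have [] := gP 0 (lexx 0) r00 j z.
pose u k z := Num.min (g z) (`|phi z| * k.+1%:R^-1).
have mu_ k : measurable_fun setT (u k).
  apply: measurable_minr => //; apply: measurable_funM => //.
  exact: measurableT_comp.
have u0 k z : 0 <= u k z by rewrite /u le_min g0 mulr_ge0.
have ug k z : `|u k z| <= g z by rewrite ger0_norm// /u ge_min lexx.
have iu k : (leb n).-integrable setT (EFin \o u k).
  apply: (le_integrable measurableT _ _ ig); first exact: measurableT_comp.
  by move=> z _; rewrite /= lee_fin (ger0_norm (g0 z)).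
have cu z : u ^~ z @ \oo --> (0 : R).
  apply: (@squeeze_cvgr _ _ _ _ (cst 0) (fun k => `|phi z| * k.+1%:R^-1)).
  - by apply: nearW => k; rewrite u0 /u ge_min lexx orbT.
  - exact: cvg_cst.
  - rewrite -[X in _ --> X](mulr0 `|phi z|).
    by apply: cvgM; [exact: cvg_cst|exact: cvg_harmonic].
have := dominated_Rintegral0 mu_ cu ig ug.
have eC : 0 < eta / (C + 1) by rewrite divr_gt0// ltr_wpDl.
move=> /cvgr_lt /(_ _ eC) [k _ /(_ k (leqnn k)) uk].
have ek : 0 < k.+1%:R^-1 :> R by rewrite invr_gt0.
have [r1 r10 eP] := remainder_uniform ek.
have [r2 r20 iA] := integrable_main_part.
exists (Num.min r0 (Num.min r1 r2)); first by rewrite !lt_min r00 r10.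
move=> h h0; rewrite !lt_min => /and3P[hr0 hr1 hr2].
have -> : \int[leb n]_z (phi z * partial j (f^~ z) lam0) +
     h ^+ p * \int[leb n]_z (X j z * phi z) = \int[leb n]_z A j h z.
  rewrite -RintegralZl// -RintegralD//;
    [|exact: idf|exact: (integrableZl measurableT _ (iX j))].
  by apply: eq_Rintegral => z _; rewrite /A -/(df j z);
    move: (X j z) (df j z) => x y; ring.
rewrite -(RintegralB measurableT (iQ j h0) (iA h h0 hr2 j)).
have iB := integrableB measurableT (iQ j h0) (iA h h0 hr2 j).
apply: le_trans (le_normr_Rintegral measurableT iB) _.
have hp : 0 <= h ^+ p by rewrite exprn_ge0// ltW.
apply: (@le_trans _ _ (\int[leb n]_z (C * h ^+ p * u k z))).
  apply: le_Rintegral => //.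
  - exact: integrable_norm iB.
  - exact: (integrableZl measurableT _ (iu k)).
  move=> z _; rewrite /u; have [_|_] := leP (g z) (`|phi z| * k.+1%:R^-1).
    by have [] := gP h (ltW h0) hr0 j z.
  exact: eP (ltW h0) hr1 j z.
rewrite RintegralZl// mulrAC ler_wpM2r//.
apply: (@le_trans _ _ (C * (eta / (C + 1)))); first by rewrite ler_wpM2l// ltW.
rewrite mulrCA ler_piMr//; first exact: ltW.
by rewrite ler_pdivrMr ?mul1r ?lerDl// ltr_wpDl.
Qed.

End bias.

(** * Moments of the estimator *)

Lemma Lfun_infty_bounded {R : realType} d' (T : measurableType d')
    (mu : {measure set T -> \bar R}) (phi : T -> R) :
  phi \in Lfun mu +oo%E ->
  measurable_fun setT phi /\ exists M, {ae mu, forall x, `|phi x| <= M}.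
Proof.
rewrite inE => /andP[/[!inE]/= mphi] /=; rewrite /finite_norm unlock => phioo.
split=> //; move: phioo; case: ifPn => [_ phioo|mu0 _].
  exact: (@ess_sup_inf.ess_supr_bounded _ _ _ _ (Num.norm \o phi)).
exists 0; exists setT; split => //.
by apply/eqP; rewrite eq_le measure_ge0 leNgt mu0.
Qed.

Section estimator.
Context {R : realType} {d n : nat} {d1 : measure_display} {Omega : measurableType d1}.
Local Notation leb k := (lebesgue_rV k : {measure set 'rV[R]_k -> \bar R}).
Variable P : probability Omega R.
Variables (phi : 'rV[R]_n -> R) (f : 'rV[R]_d -> 'rV[R]_n -> R).
Variables (lam0 : 'rV[R]_d) (K : 'rV[R]_d -> R) (M : R).
Hypotheses (mphi : measurable_fun setT phi)
  (phiM : {ae leb n, forall z, `|phi z| <= M}).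
Hypotheses (df : forall z x, differentiable (f^~ z) x)
  (cpf : forall z j, continuous (partial j (f^~ z))).
Hypothesis i_f : forall lam, (leb n).-integrable setT (EFin \o f lam).
Hypotheses (K1 : continuously_differentiable K) (K0 : forall l, ~ box l -> K l = 0).
Variables (N : nat) (h eps : R) (X : 'I_N -> {RV P >-> ('rV[R]_d * 'rV[R]_n)%type}).
Hypotheses (N0 : (0 < N)%N) (h0 : 0 < h) (heps : h <= eps).
Hypothesis indX : mutually_independent X.
Hypothesis Xf : forall i, has_density (X i)
  (product_measure1 (lebesgue_rV d) (lebesgue_rV n)) (joint_density f lam0 eps).

Let cf z : continuous (f^~ z).
Proof. by move=> x; exact: differentiable_continuous. Qed.

Let eps0 : 0 < eps. Proof. exact: lt_le_trans heps. Qed.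

Let h_neq0 : h != 0. Proof. by rewrite gt_eqF. Qed.

Let eps_neq0 : eps != 0. Proof. by rewrite gt_eqF. Qed.

Let e2_neq0 : 2 * eps != 0. Proof. by rewrite mulf_neq0// pnatr_eq0. Qed.

Let Y j := weighted_kernel lam0 h phi (partial j K).

Let c := (2 * eps) ^+ d / (N%:R * h ^+ d.+1).

Let cdK j : continuous (partial j K). Proof. exact: K1.2. Qed.

Let dK0 j : forall l, ~ box l -> partial j K l = 0.
Proof. exact: partial_outside_box. Qed.

Let mY j : measurable_fun setT (Y j).
Proof. exact: measurable_weighted_kernel. Qed.

Let iY j i : P.-integrable setT (EFin \o (Y j \o X i)).
Proof. exact: (integrable_weighted_kernel h (Xf i) mphi phiM (@cdK j) (@dK0 j)). Qed.

Let beta_hatE j w : beta_hat K phi lam0 h eps X w 0 j = c * \sum_i Y j (X i w).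
Proof.
rewrite /beta_hat mxE summxE; congr (_ * _); apply: eq_bigr => i _.
by rewrite !mxE.
Qed.

Definition smoothed_mean j := \int[leb n]_z (phi z * smoothed_partial f lam0 K j h z).

Let EY j i : \int[P]_w Y j (X i w) = (h / (2 * eps)) ^+ d * (h * smoothed_mean j) /\
  (leb n).-integrable setT (EFin \o (fun z => phi z * smoothed_partial f lam0 K j h z)).
Proof.
have [i1 E1] := expectation_kernel_inner_lam h0 heps cf (Xf i) mphi phiM (@cdK j) (@dK0 j).
have parts z : \int[leb d]_l (f (lam0 - h *: l) z * partial j K l) =
    h * smoothed_partial f lam0 K j h z.
  exact: (kernel_by_parts (G := f^~ z)).
have i2 : (leb n).-integrable setT
    (EFin \o (fun z => phi z * smoothed_partial f lam0 K j h z)).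
  have := integrableZl measurableT h^-1 i1.
  apply: eq_integrable => // z _; rewrite /= parts -EFinM; congr EFin.
  by rewrite mulrCA mulKf// gt_eqF.
split=> //; rewrite [LHS]E1; congr (_ * _); rewrite /smoothed_mean -RintegralZl//.
by apply: eq_Rintegral => z _; rewrite parts mulrCA.
Qed.

Lemma integrable_smoothed j : (leb n).-integrable setT
  (EFin \o (fun z => phi z * smoothed_partial f lam0 K j h z)).
Proof. exact: (EY j (Ordinal N0)).2. Qed.

Let N_neq0 : N%:R != 0 :> R. Proof. by rewrite pnatr_eq0 -lt0n. Qed.

(** All the normalizing factors cancel, those of eps included. *)
Lemma mean_estimator j :
  mean_rV P (beta_hat K phi lam0 h eps X) 0 j = smoothed_mean j.
Proof.
rewrite /mean_rV mxE.
have EE (H : Omega -> R) : fine ('E_P[H]) = \int[P]_w H w by rewrite unlock.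
rewrite EE; under eq_Rintegral do rewrite beta_hatE.
have iS : P.-integrable setT (EFin \o (fun w => \sum_i Y j (X i w))).
  rewrite (_ : EFin \o _ = fun w => (\sum_i (Y j (X i w))%:E)%E).
    by apply: integrable_sum => // i _; exact: iY.
  by apply/funext => w; rewrite /= sumEFin.
rewrite RintegralZl// (Rintegral_sum (F := fun i w => Y j (X i w))); last exact: iY.
under eq_bigr do rewrite (EY j _).1.
rewrite sumr_const card_ord -[_ *+ N]mulr_natl /c exprS expr_div_n.
field.
by rewrite !expf_neq0 ?h_neq0 ?e2_neq0 ?N_neq0.
Qed.

(** By independence the covariance is that of one summand, divided by N. Its second
    moment is of order (h/eps)^d, and the product of its means of order
    (h/eps)^(2d) h^2, whence the vanishing last term. *)
Lemma scaled_cov_estimator i j :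
  let W lam := \int[leb n]_z (phi z ^+ 2 * f lam z) in
  (leb d).-integrable setT
    (EFin \o (fun l => W (lam0 - h *: l) * (partial i K l * partial j K l))) /\
  N%:R * h ^+ d.+2 * (eps ^+ d)^-1 * cov_mx P (beta_hat K phi lam0 h eps X) i j =
  2 ^+ d * \int[leb d]_l (W (lam0 - h *: l) * (partial i K l * partial j K l)) -
  (h / eps) ^+ d * (h ^+ 2 * (smoothed_mean i * smoothed_mean j)).
Proof.
move=> W.
have mphi2 : measurable_fun setT (fun z => phi z ^+ 2) by exact: measurable_funX.
have phi2M : {ae leb n, forall z, `|phi z ^+ 2| <= M ^+ 2}.
  apply: filterS phiM => z zM.
  by rewrite normrX ler_pXn2r// nnegrE// (le_trans _ zM).
have iphi2f lam : (leb n).-integrable setT (EFin \o (fun z => phi z ^+ 2 * f lam z)).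
  exact: (le_Rintegral_ae_bounded mphi2 phi2M (i_f lam)).1.
pose D l := partial i K l * partial j K l.
have cD : continuous D by move=> l; apply: continuousM; exact: cdK.
have D0 l : ~ box l -> D l = 0 by move=> nbl; rewrite /D dK0// mul0r.
have YY x : Y i x * Y j x = weighted_kernel lam0 h (fun z => phi z ^+ 2) D x.
  by rewrite /Y /weighted_kernel /D; ring.
have iYY a : P.-integrable setT (EFin \o (fun w => Y i (X a w) * Y j (X a w))).
  under eq_fun do rewrite YY.
  exact: (integrable_weighted_kernel h (Xf a) mphi2 phi2M cD D0).
have EYY a := expectation_kernel_inner_z h0 heps (Xf a) mphi2 phi2M cD D0 iphi2f.
split; first exact: (EYY (Ordinal N0)).1.
have covE : cov_mx P (beta_hat K phi lam0 h eps X) i j =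
    c ^+ 2 * \sum_a (\int[P]_w (Y i (X a w) * Y j (X a w)) -
                     (\int[P]_w Y i (X a w)) * (\int[P]_w Y j (X a w))).
  rewrite -(covariance_independent_sum c indX (mY i) (mY j) (iY i) (iY j) iYY).
  rewrite /cov_mx mxE; congr (fine (covariance P _ _));
    by apply/funext => w; rewrite beta_hatE.
rewrite covE.
have -> : \sum_a (\int[P]_w (Y i (X a w) * Y j (X a w)) -
                     (\int[P]_w Y i (X a w)) * (\int[P]_w Y j (X a w))) =
  N%:R * ((h / (2 * eps)) ^+ d * \int[leb d]_l (W (lam0 - h *: l) * D l) -
    ((h / (2 * eps)) ^+ d * (h * smoothed_mean i)) *
    ((h / (2 * eps)) ^+ d * (h * smoothed_mean j))).
  rewrite mulr_natl -[in RHS](card_ord N) -sumr_const; apply: eq_bigr => a _.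
  rewrite (EY i a).1 (EY j a).1 -(EYY a).2; congr (_ - _).
  by apply: eq_Rintegral => w _; rewrite YY.
rewrite /c -/(D _); move: (\int[leb d]_l _) (smoothed_mean i) (smoothed_mean j) => I mi mj.
rewrite !expr_div_n !exprMn !exprS.
field.
by rewrite !expf_neq0 ?h_neq0 ?eps_neq0 ?N_neq0 ?pnatr_eq0.
Qed.

End estimator.

(** * Asymptotics *)

Section limits.
Context {R : realType}.

Lemma regime_near (r : R) : 0 < r ->
  \forall q \near (regime : set_system (nat * (R * R))),
    [/\ (0 < q.1)%N, 0 < q.2.1, q.2.1 < r & q.2.1 <= q.2.2].
Proof.
move=> r0; rewrite /regime /within /=.
exists ([set N | (0 < N)%N], [set x : R * R | 0 < x.1 < r]); first split => /=.
- by exists 1%N.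
- exists ([set h : R | 0 < h < r], setT); first split => /=.
  + near=> h; apply/andP; split; first by near: h; exact: nbhs_right_gt.
    by near: h; exact: nbhs_right_lt.
  + exact: filterT.
  by move=> [h e] [].
- by move=> [N [h e]] [/= N0 /andP[h0 hr]] he; split.
Unshelve. all: end_near. Qed.

(** A kernel of bandwidth h only sees W near lam0. *)
Lemma kernel_concentration (d : nat) (W D : 'rV[R]_d -> R) (lam0 : 'rV[R]_d) (e : R) :
  W lam @[lam --> lam0] --> W lam0 ->
  continuous D -> (forall l, ~ box l -> D l = 0) -> 0 < e ->
  exists2 r, 0 < r & forall h, 0 < h -> h < r ->
    (lebesgue_rV d).-integrable setT (EFin \o (fun l => W (lam0 - h *: l) * D l)) ->
    `|\int[lebesgue_rV d]_l (W (lam0 - h *: l) * D l) -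
      W lam0 * \int[lebesgue_rV d]_l D l| <= e.
Proof.
move=> cW cD D0 e0.
have iD := integrable_continuous_box cD D0.
pose I := \int[lebesgue_rV d]_l `|D l|.
have I0 : 0 <= I by exact: Rintegral_ge0.
have eI : 0 < e / (I + 1) by rewrite divr_gt0// ltr_wpDl.
have /cvgrPdist_le/(_ _ eI)/nbhs_ballP[r r0 rW] := cW.
exists r => // h h0 hr iWD.
have iWD0 := integrableZl measurableT (W lam0) iD.
rewrite -RintegralZl// -RintegralB//.
have iB := integrableB measurableT iWD iWD0.
apply: le_trans (le_normr_Rintegral measurableT iB) _.
have inD := integrable_norm iD.
apply: (@le_trans _ _ (e / (I + 1) * I)); last first.
  by rewrite -mulrA ler_piMr ?ltW// mulrC ltr_pdivrMr ?mul1r ?ltrDl// ltr_wpDl.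
rewrite -RintegralZl//; apply: le_Rintegral => //.
- exact: integrable_norm iB.
- exact: (integrableZl measurableT _ inD).
move=> l _; have [bl|nbl] := pselect (box l);
  last by rewrite D0// !mulr0 subrr normr0 mulr0.
rewrite -mulrBl normrM ler_wpM2r// distrC; apply: rW.
rewrite -ball_normE /= opprB addrCA subrr addr0 normrZ gtr0_norm//.
by apply: le_lt_trans hr; rewrite ler_piMr ?box_norm// ltW.
Qed.

End limits.

Theorem proposition4p3 (R : realType) (d n p : nat)
    (f : 'rV[R]_d -> 'rV[R]_n -> R) (phi : 'rV[R]_n -> R)
    (lam0 : 'rV[R]_d) (K : 'rV[R]_d -> R)
    (d0 : measure_display) (Omega0 : measurableType d0)
    (P0 : probability Omega0 R) (Z : 'rV[R]_d -> {RV P0 >-> 'rV[R]_n})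
    (d1 : measure_display) (Omega : nat -> R -> measurableType d1)
    (P : forall N eps, probability (Omega N eps) R)
    (X : forall N eps, 'I_N -> {RV (P N eps) >-> ('rV[R]_d * 'rV[R]_n)%type}) :
  let V := fun lam => fine ('E_P0[phi \o Z lam])%E in
  let beta := grad V lam0 in
  let score := fun z => grad (fun lam => ln (f lam z)) lam0 in
  (forall lam, has_density (Z lam) (lebesgue_rV n) (f lam)) ->
  phi \in Lfun (lebesgue_rV n) +oo%E ->
  differentiable V lam0 ->
  beta = \row_j fine ('E_P0[fun w => (phi (Z lam0 w) * score (Z lam0 w) 0 j)%R])%E ->
  beta = \row_j (\int[lebesgue_rV n]_z (phi z * partial j (f^~ z) lam0)) ->
  ('E_P0[fun w => (\sum_j (score (Z lam0 w) 0 j) ^+ 2)%R] < +oo)%E ->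
  (forall N eps, 0 < eps ->
    mutually_independent (@X N eps) /\
    forall i, has_density (@X N eps i)
      (product_measure1 (lebesgue_rV d) (lebesgue_rV n))
      (joint_density f lam0 eps)) ->
  assumption_K K p ->
  supp K `<=` [set l : 'rV[R]_d | forall i, -1 <= l 0 i <= 1] ->
  assumption_R3 phi f lam0 p ->
  dominated_increments phi f lam0 p ->
  let estimate := fun q : nat * (R * R) =>
    beta_hat K phi lam0 q.2.1 q.2.2 (@X q.1 q.2.2) in
  let C_u := bias_vector K p phi f lam0 in
  let Sigma_u := variance_mx K (fine ('E_P0[fun w => (phi (Z lam0 w) ^+ 2)%R])%E) in
  (fun q => mean_rV (P q.1 q.2.2) (estimate q) - beta) =
    (fun q => q.2.1 ^+ p *: C_u) +o_regime (fun q => q.2.1 ^+ p) /\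
  (q.1%:R * q.2.1 ^+ d.+2 * (q.2.2 ^+ d)^-1) *:
    cov_mx (P q.1 q.2.2) (estimate q) @[q --> regime] --> Sigma_u.
Proof.
move=> V beta score Zf phioo _ _ betaE _ Xf AK suppK R3 dom estimate C_u Sigma_u.
have [mphi [M phiM]] := Lfun_infty_bounded phioo.
have K0 l : ~ box l -> K l = 0.
  move=> nbl; apply/eqP; apply: contrapT => /negP Kl; apply: nbl.
  by apply: suppK; exact: subset_closure.
have K1 : continuously_differentiable K by case: AK.
have p0 : (0 < p)%N by case: AK => _ _ _ [].
have mf lam : measurable_fun setT (f lam) by case: (Zf lam).
have fge0 lam z : 0 <= f lam z by case: (Zf lam).
have i_f lam := integrable_density (Zf lam).
have df z x : differentiable (f^~ z) x.
  exact: (times_differentiable_iter_partial (J := [::]) (R3.1 z)).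
have cpf z j : continuous (partial j (f^~ z)).
  move=> x; apply: differentiable_continuous.
  exact: (times_differentiable_iter_partial (J := [:: j]) (R3.1 z)).
pose b h j := smoothed_mean phi f lam0 K h j.
have moments q : (0 < q.1)%N -> 0 < q.2.1 -> q.2.1 <= q.2.2 ->
    (forall j, mean_rV (P q.1 q.2.2) (estimate q) 0 j = b q.2.1 j) /\
    forall i j,
    let W lam := \int[lebesgue_rV n]_z (phi z ^+ 2 * f lam z) in
    (lebesgue_rV d).-integrable setT
      (EFin \o (fun l => W (lam0 - q.2.1 *: l) * (partial i K l * partial j K l))) /\
    q.1%:R * q.2.1 ^+ d.+2 * (q.2.2 ^+ d)^-1 * cov_mx (P q.1 q.2.2) (estimate q) i j =
      2 ^+ d * \int[lebesgue_rV d]_l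
        (W (lam0 - q.2.1 *: l) * (partial i K l * partial j K l)) -
      (q.2.1 / q.2.2) ^+ d * (q.2.1 ^+ 2 * (b q.2.1 i * b q.2.1 j)).
  case: q => N [h eps] /= N0 h0 heps.
  have [indX XN] := Xf N eps (lt_le_trans h0 heps).
  split=> [j|i j].
    exact: (mean_estimator mphi phiM df cpf K1 K0 N0 h0 heps XN).
  exact: (scaled_cov_estimator mphi phiM df cpf i_f K1 K0 N0 h0 heps indX XN i j).
(* Samples of size one with eps = h suffice for the integrability. *)
have iQ j h : 0 < h -> (lebesgue_rV n).-integrable setT
    (EFin \o (fun z => phi z * smoothed_partial f lam0 K j h z)).
  move=> h0; have [_ XN] := Xf 1%N h h0.
  exact: (integrable_smoothed mphi phiM df cpf K1 K0 (ltn0Sn 0) h0 (lexx h) XN).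
have bias j eta : 0 < eta -> exists2 r, 0 < r & forall h, 0 < h -> h < r ->
    `|b h j - beta 0 j - h ^+ p * C_u 0 j| <= eta * h ^+ p.
  move=> eta0; have [r r0 rP] := bias_expansion mphi mf AK K0 R3 dom iQ j eta0.
  exists r => // h h0 hr; have := rP h h0 hr.
  by rewrite betaE /C_u /bias_vector !mxE opprD addrA.
have near_all (T : finType) (Q : T -> R -> Prop) :
    (forall t, exists2 r, 0 < r & forall h, 0 < h -> h < r -> Q t h) ->
    \forall q \near (regime : set_system (nat * (R * R))),
      [/\ (0 < q.1)%N, 0 < q.2.1 < 1, q.2.1 <= q.2.2 & forall t, Q t q.2.1].
  move=> Qr; have : forall t, \forall q \near (regime : set_system (nat * (R * R))),
      Q t q.2.1.
    move=> t; have [r r0 rQ] := Qr t.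
    by apply: filterS (regime_near r0) => q [_ q0 qr _]; exact: rQ.
  move=> /filter_forall; apply: filterS2 (regime_near ltr01) => q [N0 h0 h1 he] Qq.
  by split=> //; rewrite h0.
split.
  apply/eqaddoP => eta eta0.
  have := near_all _ _ (fun j => bias j eta eta0).
  apply: filterS => q [N0 /andP[h0 _] he biasq].
  have [meanq _] := moments q N0 h0 he.
  have hp : 0 <= q.2.1 ^+ p by rewrite exprn_ge0// ltW.
  rewrite [X in _ <= _ * X]ger0_norm//.
  apply: mx_norm_le => [|i j]; first by rewrite mulr_ge0// ltW.
  have -> : ((fun q => mean_rV (P q.1 q.2.2) (estimate q) - beta) -
      (fun q => q.2.1 ^+ p *: C_u)) q i j =
      mean_rV (P q.1 q.2.2) (estimate q) i j - beta i j - q.2.1 ^+ p * C_u i j.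
    by rewrite !mxE.
  by rewrite (ord1 i) meanq; exact: biasq.
pose W lam := \int[lebesgue_rV n]_z (phi z ^+ 2 * f lam z).
have mphi2 : measurable_fun setT (fun z => phi z ^+ 2) by exact: measurable_funX.
have phi2M : {ae (lebesgue_rV n : {measure set 'rV[R]_n -> \bar R}),
    forall z, `|phi z ^+ 2| <= M ^+ 2}.
  apply: filterS phiM => z zM.
  by rewrite normrX ler_pXn2r// nnegrE// (le_trans _ zM).
have cW : W lam @[lam --> lam0] --> W lam0.
  apply: density_integral_continuous phi2M => //.
  - by move=> lam; rewrite /Rintegral (integral_density (Zf lam)).
  - by move=> z; exact: differentiable_continuous.
have EW : fine ('E_P0[fun w => (phi (Z lam0 w) ^+ 2)%R])%E = W lam0.
  by rewrite unlock; exact: (expectation_density (Zf lam0) mphi2).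
apply/cvgrPdist_le => e e0.
(* A bound on the means, for bandwidths below 1. *)
pose B := \big[Num.max/0]_j (`|beta 0 j| + `|C_u 0 j| + 1).
have B0 : 0 <= B by apply: bigmax_ge_id.
have bB j : exists2 r, 0 < r & forall h, 0 < h -> h < r -> h < 1 -> `|b h j| <= B.
  have [r r0 rP] := bias j 1 ltr01; exists r => // h h0 hr h1.
  have hp1 : 0 <= h ^+ p <= 1 by rewrite exprn_ge0 ?exprn_ile1 ?ltW.
  have [hp0 hp] := andP hp1.
  apply: le_trans (le_bigmax _ (fun j => `|beta 0 j| + `|C_u 0 j| + 1) j).
  have -> : b h j = beta 0 j + h ^+ p * C_u 0 j + (b h j - beta 0 j - h ^+ p * C_u 0 j).
    by ring.
  apply: le_trans (ler_normD _ _) _; apply: lerD.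
    apply: le_trans (ler_normD _ _) _; rewrite lerD2l normrM (ger0_norm hp0).
    by rewrite ler_piMl.
  by apply: le_trans (rP h h0 hr) _; rewrite mul1r.
have Q i j : exists2 r, 0 < r & forall h, 0 < h -> h < r ->
    (lebesgue_rV d).-integrable setT
      (EFin \o (fun l => W (lam0 - h *: l) * (partial i K l * partial j K l))) ->
    `|\int[lebesgue_rV d]_l (W (lam0 - h *: l) * (partial i K l * partial j K l)) -
      W lam0 * \int[lebesgue_rV d]_l (partial i K l * partial j K l)|
      <= e / 2 / 2 ^+ d.
  apply: kernel_concentration => //.
  - by move=> l; apply: continuousM; exact: K1.2.
  - by move=> l nbl; rewrite (partial_outside_box i K0 nbl) mul0r.
  - by rewrite !divr_gt0// exprn_gt0.
have smallB (t : unit) : exists2 r, 0 < r & forall h, 0 < h -> h < r ->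
    h * (B * B) <= e / 2.
  have BB : 0 < B * B + 1 by rewrite ltr_wpDl// mulr_ge0.
  exists (e / 2 / (B * B + 1)); first by rewrite !divr_gt0.
  move=> h h0; rewrite ltr_pdivlMr// => /ltW hB; apply: le_trans hB.
  by rewrite ler_wpM2l ?lerDl// ltW.
have nB := near_all _ _ bB.
have nQ := near_all _ _ (fun ij : 'I_d * 'I_d => Q ij.1 ij.2).
have nS := near_all _ _ smallB.
apply: filterS3 nB nQ nS => q [N0 /andP[h0 h1] he bq] [_ _ _ Qq] [_ _ _ Sq].
have [_ covq] := moments q N0 h0 he.
apply: mx_norm_le => [|i j]; first exact: ltW.
have [iWD E] := covq i j.
have subE (S T : 'M[R]_d) (c : R) : (S - c *: T) i j = S i j - c * T i j.
  by rewrite !mxE.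
rewrite subE E; set I := \int[_]_l (W _ * _).
have -> : Sigma_u i j =
    2 ^+ d * (W lam0 * \int[lebesgue_rV d]_l (partial i K l * partial j K l)).
  by rewrite /Sigma_u /variance_mx !mxE EW mulrA.
have two0 : 0 < 2 ^+ d :> R by rewrite exprn_gt0.
rewrite opprB addrCA -mulrBr; apply: le_trans (ler_normD _ _) _.
rewrite [leRHS](splitr e) lerD//; last first.
  rewrite normrM (gtr0_norm two0) distrC -ler_pdivlMl// [leRHS]mulrC.
  exact: (Qq (i, j) iWD).
have eps0 : 0 < q.2.2 by exact: lt_le_trans he.
have heps0 : 0 <= q.2.1 / q.2.2 by rewrite divr_ge0// ltW.
rewrite normrM ger0_norm ?exprn_ge0//; apply: le_trans (Sq tt).
rewrite -[leRHS]mul1r ler_pM ?exprn_ge0 ?normr_ge0//.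
  by rewrite exprn_ile1// ler_pdivrMr// mul1r.
have h20 : 0 <= q.2.1 ^+ 2 by rewrite exprn_ge0// ltW.
rewrite normrM (ger0_norm h20) ler_pM//.
  by rewrite expr2 ler_piMl// ltW.
by rewrite normrM ler_pM// bq.
Qed.
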